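(* For every $D\ge D_{\min}$, the capacity-distortion function of the bistatic ISAC channel satisfies $$C(D)\ \le\ \max_{P_{UVX}}\ \min\big\{ I(X;Y|S),\ \ I(X;Y|U,S)+I(U;Z),\ \ I(X;Y,Z|U,V,S)+I(U,V;Z)\big\},$$ where the maximum is over all pmfs $P_{UVX}=P_{UV}P_{X|UV}$ on $\mathcal U\times\mathcal V\times\mathcal X$ such that $$\mathbb E\big[d\big(S,\hat s^*(U,V,Z)\big)\big]\le D,$$ the joint distribution of $(U,V,S,X,Y,Z)$ is $P_{UV}P_{X|UV}P_SP_{YZ|XS}$, the estimator is $$\hat s^*(u,v,z)=\arg\min_{s'\in\hat{\mathcal S}}\sum_{s\in\mathcal S}P_{S|UVZ}(s|u,v,z)\,d(s,s')$$ (ties broken arbitrarily), and the cardinalities of the auxiliary random variables satisfy $|\mathcal U|\le|\mathcal X|+2$ and $|\mathcal V|\le|\mathcal U||\mathcal X|+1$.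
   Context: Bistatic ISAC model. $\mathcal X,\mathcal S,\mathcal Y,\mathcal Z,\hat{\mathcal S}$ are finite sets, $P_S$ is a pmf on $\mathcal S$, $P_{YZ|XS}=p(y,z|x,s)$ is a conditional pmf on $\mathcal Y\times\mathcal Z$ given $(x,s)\in\mathcal X\times\mathcal S$, and $d:\mathcal S\times\hat{\mathcal S}\to\mathbb R_+$ is a (bounded) distortion function. The state sequence $S^n$ is i.i.d. $\sim P_S$ and independent of the message; the channel is memoryless: given $(x^n,s^n)$, $(Y^n,Z^n)$ has pmf $\prod_i p(y_i,z_i|x_i,s_i)$ (no feedback). The communication receiver observes $Y^n$ and knows $S^n$ (noncausally); the sensing receiver observes only $Z^n$ (it knows the codebook but not the message). A $(2^{nR},n)$ code consists of a message set $[1:2^{nR}]=\{1,\dots,\lceil 2^{nR}\rceil\}$, an encoder $w\mapsto x^n(w)\in\mathcal X^n$, a decoder $(y^n,s^n)\mapsto\hat w$, and a state estimator $h:\mathcal Z^n\to\hat{\mathcal S}^n$, $\hat S^n=h(Z^n)$. The message $W$ is uniform on the message set. $P_e^{(n)}=\Pr\{\hat W\ne W\}$ and $D^{(n)}=\frac1n\sum_{i=1}^n\mathbb E[d(S_i,\hat S_i)]$. A pair $(R,D)$ is achievable if there is a sequence of $(2^{nR},n)$ codes with $\lim_n P_e^{(n)}=0$ and $\limsup_n D^{(n)}\le D$. The capacity-distortion function is $C(D)=\max\{R\ge 0:(R,D)\text{ achievable}\}$. $D_{\min}$ is the minimum of $\mathbb E[d(S,\hat s(Z))]$ over all pmfs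 $P_X$ on $\mathcal X$ and all maps $\hat s:\mathcal Z\to\hat{\mathcal S}$, with $(X,S,Y,Z)\sim P_XP_SP_{YZ|XS}$. Information quantities are in bits. *)

(* Defs.v *)
From HB Require Import structures.
From mathcomp Require Import all_boot all_order all_algebra.
From mathcomp Require Import all_classical all_reals all_analysis.

Set Implicit Arguments.
Unset Strict Implicit.
Unset Printing Implicit Defensive.

Import Order.TTheory GRing.Theory Num.Theory.
Import numFieldNormedType.Exports.

Local Open Scope classical_set_scope.
Local Open Scope ring_scope.

Section FiniteProbability.
Variables (R : realType) (T : finType).
Implicit Type p : T -> R.

Definition is_pmf p : Prop := (forall t, 0 <= p t) /\ \sum_t p t = 1.

Definition Pr p (E : pred T) : R := \sum_(t | E t) p t.

(* Equal to 0 when the conditioning event has probability 0. *)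
Definition cPr p (E F : pred T) : R := Pr p (predI E F) / Pr p F.

Definition Ex p (f : T -> R) : R := \sum_t p t * f t.

Definition log2 (x : R) : R := ln x / ln 2.

(* Random variables are functions on the sample space [T]; tuples of random
   variables are random variables with values in a product type.  The
   convention 0 log (0 / 0) = 0 holds because the factor in front of the
   logarithm vanishes whenever a denominator does. *)
Definition mutual_info (A B : finType) p (X : T -> A) (Y : T -> B) : R :=
  \sum_a \sum_b
    Pr p [pred t | (X t == a) && (Y t == b)] *
    log2 (Pr p [pred t | (X t == a) && (Y t == b)] /
          (Pr p [pred t | X t == a] * Pr p [pred t | Y t == b])).

Definition cond_mutual_info (A B C : finType) p
    (X : T -> A) (Y : T -> B) (Q : T -> C) : R :=
  \sum_a \sum_b \sum_c
    Pr p [pred t | [&& X t == a, Y t == b & Q t == c]] *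
    log2 (cPr p [pred t | (X t == a) && (Y t == b)] [pred t | Q t == c] /
          (cPr p [pred t | X t == a] [pred t | Q t == c] *
           cPr p [pred t | Y t == b] [pred t | Q t == c])).

End FiniteProbability.

Record isac_channel (R : realType) (X S Y Z Sh : finType) := IsacChannel {
  state_pmf : S -> R;
  transition : X -> S -> Y * Z -> R;
  distortion : S -> Sh -> R;
  state_pmfP : is_pmf state_pmf;
  transitionP : forall x s, is_pmf (transition x s);
  distortion_ge0 : forall s s', 0 <= distortion s s'
}.

Section Isac.
Variables (R : realType) (X S Y Z Sh : finType).
Variable ch : isac_channel R X S Y Z Sh.

Record isac_code (M n : nat) := Code {
  encoder : 'I_M -> {ffun 'I_n -> X};
  decoder : {ffun 'I_n -> Y} -> {ffun 'I_n -> S} -> 'I_M;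
  estimator : {ffun 'I_n -> Z} -> {ffun 'I_n -> Sh}
}.

Section CodePerformance.
Variables (M n : nat) (c : isac_code M n).

Definition code_space : finType :=
  ('I_M * {ffun 'I_n -> S} * {ffun 'I_n -> Y} * {ffun 'I_n -> Z})%type.

(* Joint law of (W, S^n, Y^n, Z^n). *)
Definition code_law (t : code_space) : R :=
  let: (w, s, y, z) := t in
  M%:R^-1 *
  (\prod_(i < n) state_pmf ch (s i)) *
  (\prod_(i < n) transition ch (encoder c w i) (s i) (y i, z i)).

Definition error_probability : R :=
  Pr code_law [pred t : code_space |
    let: (w, s, y, z) := t in decoder c y s != w].

Definition average_distortion : R :=
  n%:R^-1 * \sum_(i < n) Ex code_law (fun t : code_space =>
    let: (w, s, y, z) := t in distortion ch (s i) (estimator c z i)).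

End CodePerformance.

Definition num_messages (r : R) (n : nat) : nat :=
  `|Num.ceil (2 `^ (n%:R * r))|%N.

Definition achievable (r D : R) : Prop :=
  exists c : forall n, isac_code (num_messages r n) n,
    (error_probability (c n) @[n --> \oo] --> (0 : R)) /\
    (limn_esup (fun n => (average_distortion (c n))%:E) <= D%:E)%E.

(* A supremum: with exactly ceil(2^(nR)) messages at blocklength n, the
   boundary rate itself need not be achievable. *)
Definition capacity_distortion (D : R) : \bar R :=
  ereal_sup [set r%:E | r in [set r : R | 0 <= r /\ achievable r D]].

(* The infimum is a minimum as soon as X and Sh are nonempty (finitely many
   estimators, compact simplex of input pmfs). *)
Definition Dmin : \bar R :=
  ereal_inf [set e%:E | e in [set e : R |
    exists (PX : X -> R) (sh : Z -> Sh), is_pmf PX /\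
      e = Ex (fun t : X * S * (Y * Z) =>
                let: (x, s, yz) := t in
                PX x * state_pmf ch s * transition ch x s yz)
             (fun t : X * S * (Y * Z) =>
                let: (x, s, (y, z)) := t in distortion ch s (sh z))]].

Section SingleLetter.
Variables (U V : finType) (P : U * V * X -> R).

Definition letter_space : finType := (U * V * S * X * Y * Z)%type.

(* Joint law of (U, V, S, X, Y, Z). *)
Definition letter_law (t : letter_space) : R :=
  let: (u, v, s, x, y, z) := t in
  P (u, v, x) * state_pmf ch s * transition ch x s (y, z).

Definition rvU (t : letter_space) : U := let: (u, v, s, x, y, z) := t in u.
Definition rvV (t : letter_space) : V := let: (u, v, s, x, y, z) := t in v.
Definition rvS (t : letter_space) : S := let: (u, v, s, x, y, z) := t in s.
Definition rvX (t : letter_space) : X := let: (u, v, s, x, y, z) := t in x.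
Definition rvY (t : letter_space) : Y := let: (u, v, s, x, y, z) := t in y.
Definition rvZ (t : letter_space) : Z := let: (u, v, s, x, y, z) := t in z.

Definition posterior_cost (u : U) (v : V) (z : Z) (s' : Sh) : R :=
  \sum_s cPr letter_law [pred t | rvS t == s]
           [pred t | [&& rvU t == u, rvV t == v & rvZ t == z]] *
         distortion ch s s'.

(* [sh] is an argmin of the posterior cost, with any tie-breaking; at triples
   (u, v, z) of probability 0 the cost is constantly 0 and [sh] is free. *)
Definition optimal_estimator (sh : U -> V -> Z -> Sh) : Prop :=
  forall u v z s', posterior_cost u v z (sh u v z) <= posterior_cost u v z s'.

(* All optimal estimators have the same expected distortion, so the choice of
   tie-breaking is immaterial. *)
Definition distortion_feasible (D : R) : Prop :=
  exists2 sh : U -> V -> Z -> Sh, optimal_estimator sh &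
    Ex letter_law (fun t =>
      distortion ch (rvS t) (sh (rvU t) (rvV t) (rvZ t))) <= D.

Definition rate_bound : R :=
  let I A B := @mutual_info R letter_space A B letter_law in
  let Ic A B C := @cond_mutual_info R letter_space A B C letter_law in
  let US t := (rvU t, rvS t) in
  let UV t := (rvU t, rvV t) in
  let UVS t := (rvU t, rvV t, rvS t) in
  let YZ t := (rvY t, rvZ t) in
  Num.min (Ic _ _ _ rvX rvY rvS)
    (Num.min (Ic _ _ _ rvX rvY US + I _ _ rvU rvZ)
             (Ic _ _ _ rvX YZ UVS + I _ _ UV rvZ)).

End SingleLetter.

Definition outer_values (D : R) : set R :=
  [set m | exists (U V : finType) (P : U * V * X -> R),
    [/\ (#|U| <= #|X| + 2)%N, (#|V| <= #|U| * #|X| + 1)%N,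
        is_pmf P, distortion_feasible P D & m = rate_bound P]].

End Isac.

Definition is_maximum (R : realType) (A : set R) (m : R) : Prop :=
  A m /\ ubound A m.

(* Main.v *)
(* The auxiliary variable U can be taken trivial. Given a code, let i be a
   uniform time index, V the pair of i and of the sensing output Z^n with its
   i-th letter erased, and (S, X, Y, Z) the letters at time i. Since (V, X) is
   independent of S and the channel is memoryless, (V, S, X, Y, Z) follows the
   single-letter law of (V, X), and V together with Z determines Z^n, hence the
   estimate of S, so that the distortion is that of the code.

   Both rate bounds are changes of measure. If r is the information density of
   I(X;Y|S), resp. of I(X;Y,Z|V,S) + I(V;Z), then multiplying the law of the
   code by the message guess of Fano's inequality and by the inverse of the
   product of the r's yields a subprobability: for the first bound it is
   dominated by prod_i P(s_i) P(y_i|s_i), and for the second one by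
   prod_i P(z_i) P(s_i,y_i|v_i,z_i), which sums to at most 1 because v_i is a
   function of Z^n only. Jensen's inequality for ln then bounds log M.

   The cardinality of V is reduced by a basic solution of the linear program
   that minimizes the distortion given P_X and the second information, and the
   limit as n grows follows from compactness of the simplex and continuity of
   the rate bound, which also provides the maximum. *)
Require Import Defs.
From mathcomp Require Import all_boot all_order all_algebra.
From mathcomp Require Import all_classical all_reals all_analysis.
From mathcomp Require Import ring lra.

Set Implicit Arguments.
Unset Strict Implicit.
Unset Printing Implicit Defensive.

Import Order.TTheory GRing.Theory Num.Theory.
Import numFieldNormedType.Exports.

Local Open Scope ring_scope.

(** * Finite probability *)

Lemma ln_cond_ratio (R : realType) (a b c q : R) :
  0 < a -> 0 < b -> 0 < c -> 0 < q ->
  ln ((a / q) / ((b / q) * (c / q))) = ln a + ln q - ln b - ln c.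
Proof.
move=> a0 b0 c0 q0.
have -> : (a / q) / ((b / q) * (c / q)) = (a * q) / (b * c).
  by field; rewrite !gt_eqF.
by rewrite ln_div ?posrE ?mulr_gt0// !lnM ?posrE//; ring.
Qed.

Section Probability.
Variables (R : realType) (T : finType).
Implicit Types (p : T -> R) (f g : T -> R) (E F : pred T).

Lemma Pr_Ex p E : Pr p E = Ex p (fun t => (E t)%:R).
Proof.
rewrite /Pr /Ex big_mkcond; apply: eq_bigr => t _.
by case: (E t); rewrite ?mulr1 ?mulr0.
Qed.

Lemma eq_Ex p f g : (forall t, p t != 0 -> f t = g t) -> Ex p f = Ex p g.
Proof.
move=> fg; apply: eq_bigr => t _.
by have [->|/fg ->] := eqVneq (p t) 0; rewrite ?mul0r.
Qed.

Lemma ExD p f g : Ex p (fun t => f t + g t) = Ex p f + Ex p g.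
Proof. by rewrite -big_split; apply: eq_bigr => t _; rewrite mulrDr. Qed.

Lemma ExMr p (c : R) f : Ex p (fun t => f t * c) = Ex p f * c.
Proof. by rewrite mulr_suml; apply: eq_bigr => t _; rewrite mulrA. Qed.

Lemma ExN p f : Ex p (fun t => - f t) = - Ex p f.
Proof. by rewrite -sumrN; apply: eq_bigr => t _; rewrite mulrN. Qed.

Lemma ExB p f g : Ex p (fun t => f t - g t) = Ex p f - Ex p g.
Proof. by rewrite ExD ExN. Qed.

Lemma Ex_sum (I : finType) p (f : I -> T -> R) :
  Ex p (fun t => \sum_i f i t) = \sum_i Ex p (f i).
Proof.
by rewrite exchange_big; apply: eq_bigr => t _; rewrite mulr_sumr.
Qed.

Lemma Ex_cst p (c : R) : is_pmf p -> Ex p (fun=> c) = c.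
Proof. by case=> _ p1; rewrite /Ex -mulr_suml p1 mul1r. Qed.

Lemma le_Ex p f g : (forall t, 0 <= p t) ->
  (forall t, p t != 0 -> f t <= g t) -> Ex p f <= Ex p g.
Proof.
move=> p0 fg; apply: ler_sum => t _.
have [->|/fg fgt] := eqVneq (p t) 0; first by rewrite !mul0r.
exact: ler_wpM2l.
Qed.

Lemma Pr_ge0 p E : (forall t, 0 <= p t) -> 0 <= Pr p E.
Proof. by move=> p0; apply: sumr_ge0. Qed.

Lemma eq_Pr p E F : (forall t, p t != 0 -> E t = F t) -> Pr p E = Pr p F.
Proof. by move=> EF; rewrite !Pr_Ex; apply: eq_Ex => t /EF ->. Qed.

Lemma Pr_gt0 p E t : (forall t, 0 <= p t) -> p t != 0 -> E t -> 0 < Pr p E.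
Proof.
move=> p0 pt Et; rewrite /Pr (bigD1 t)//=.
by rewrite ltr_pwDl ?lt0r ?pt ?p0//; apply: sumr_ge0.
Qed.

Lemma Pr_neq0 p E t : (forall t, 0 <= p t) -> p t != 0 -> E t -> Pr p E != 0.
Proof. by move=> p0 pt Et; rewrite gt_eqF// (Pr_gt0 p0 pt). Qed.

Lemma Ex_rv (A : finType) p (X : T -> A) (F : A -> R) :
  Ex p (fun t => F (X t)) = \sum_a Pr p [pred t | X t == a] * F a.
Proof.
rewrite /Ex (partition_big X xpredT)//=; apply: eq_bigr => a _.
by rewrite mulr_suml; apply: eq_bigr => t /eqP ->.
Qed.

Lemma sum_Pr (A : finType) p (X : T -> A) E :
  \sum_a Pr p [pred t | (X t == a) && E t] = Pr p E.
Proof.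
rewrite /Pr [RHS](partition_big X xpredT)//=; apply: eq_bigr => a _.
by apply: eq_bigl => t /=; rewrite andbC.
Qed.

Lemma sum_cPr_le1 (A : finType) p (X : T -> A) E : (forall t, 0 <= p t) ->
  \sum_a cPr p [pred t | X t == a] E <= 1.
Proof.
move=> p0; rewrite /cPr -mulr_suml.
rewrite (eq_bigr (fun a => Pr p [pred t | (X t == a) && E t]))// sum_Pr.
have [->|?] := eqVneq (Pr p E) 0; first by rewrite mul0r ler01.
by rewrite divff.
Qed.

(** Exponential of the information density: [mutual_info] is the mean of its [log2]. *)
Definition info_ratio (A B : finType) p (X : T -> A) (Y : T -> B) (a : A) (b : B) : R :=
  Pr p [pred t | (X t == a) && (Y t == b)] /
  (Pr p [pred t | X t == a] * Pr p [pred t | Y t == b]).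

Definition cond_info_ratio (A B C : finType) p (X : T -> A) (Y : T -> B)
    (Q : T -> C) (a : A) (b : B) (c : C) : R :=
  cPr p [pred t | (X t == a) && (Y t == b)] [pred t | Q t == c] /
  (cPr p [pred t | X t == a] [pred t | Q t == c] *
   cPr p [pred t | Y t == b] [pred t | Q t == c]).

Lemma mutual_info_Ex (A B : finType) p (X : T -> A) (Y : T -> B) :
  mutual_info p X Y = Ex p (fun t => log2 (info_ratio p X Y (X t) (Y t))).
Proof.
rewrite (Ex_rv p (fun t => (X t, Y t))
  (fun ab => log2 (info_ratio p X Y ab.1 ab.2))) /mutual_info pair_bigA/=.
by apply: eq_bigr => -[a b] _.
Qed.

Lemma cond_mutual_info_Ex (A B C : finType) p
    (X : T -> A) (Y : T -> B) (Q : T -> C) :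
  cond_mutual_info p X Y Q =
  Ex p (fun t => log2 (cond_info_ratio p X Y Q (X t) (Y t) (Q t))).
Proof.
rewrite (Ex_rv p (fun t => (X t, (Y t, Q t)))
  (fun abc => log2 (cond_info_ratio p X Y Q abc.1 abc.2.1 abc.2.2))).
rewrite /cond_mutual_info; under eq_bigr do rewrite pair_bigA.
by rewrite pair_bigA/=; apply: eq_bigr => -[a [b c]] _.
Qed.

Lemma info_ratio_gt0 (A B : finType) p (X : T -> A) (Y : T -> B) t :
  (forall t, 0 <= p t) -> p t != 0 -> 0 < info_ratio p X Y (X t) (Y t).
Proof.
move=> p0 pt; rewrite /info_ratio.
by rewrite ?divr_gt0 ?mulr_gt0 ?(Pr_gt0 p0 pt)//= ?eqxx.
Qed.

Lemma cond_info_ratio_gt0 (A B C : finType) p (X : T -> A) (Y : T -> B)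
    (Q : T -> C) t :
  (forall t, 0 <= p t) -> p t != 0 ->
  0 < cond_info_ratio p X Y Q (X t) (Y t) (Q t).
Proof.
move=> p0 pt; rewrite /cond_info_ratio /cPr.
by rewrite ?(divr_gt0, mulr_gt0) ?(Pr_gt0 p0 pt)//= ?eqxx.
Qed.

(* Up to sign, the entropy of [X] in nats. *)
Definition neg_entropy (A : finType) p (X : T -> A) : R :=
  \sum_a Pr p [pred t | X t == a] * ln (Pr p [pred t | X t == a]).

Lemma neg_entropy_Ex (A : finType) p (X : T -> A) :
  neg_entropy p X = Ex p (fun t => ln (Pr p [pred t' | X t' == X t])).
Proof. by rewrite (Ex_rv p X (fun a => ln (Pr p [pred t | X t == a]))). Qed.

(** On the support all probabilities involved are positive, so the logarithm splits. The entropy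
    form serves for continuity, since x ln x is continuous at 0. *)
Lemma mutual_infoE (A B : finType) p (X : T -> A) (Y : T -> B) :
  (forall t, 0 <= p t) ->
  mutual_info p X Y =
  (neg_entropy p (fun t => (X t, Y t)) - neg_entropy p X - neg_entropy p Y) / ln 2.
Proof.
move=> p0; rewrite mutual_info_Ex !neg_entropy_Ex -!ExB -ExMr.
apply: eq_Ex => t pt; rewrite /log2; congr (_ / _).
rewrite ln_div ?posrE ?mulr_gt0 ?(Pr_gt0 p0 pt)//= ?eqxx//.
rewrite lnM ?posrE ?(Pr_gt0 p0 pt)//= opprD addrA; congr (_ - _ - _).
Qed.

Lemma cond_mutual_infoE (A B C : finType) p
    (X : T -> A) (Y : T -> B) (Q : T -> C) : (forall t, 0 <= p t) ->
  cond_mutual_info p X Y Q =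
  (neg_entropy p (fun t => (X t, Y t, Q t)) + neg_entropy p Q
   - neg_entropy p (fun t => (X t, Q t))
   - neg_entropy p (fun t => (Y t, Q t))) / ln 2.
Proof.
move=> p0; rewrite cond_mutual_info_Ex !neg_entropy_Ex -ExD -!ExB -ExMr.
apply: eq_Ex => t pt; rewrite /log2; congr (_ / _).
have P1 : 0 < Pr p (predI [pred t' | (X t' == X t) && (Y t' == Y t)] [pred t' | Q t' == Q t]).
  by rewrite (Pr_gt0 p0 pt)//= !eqxx.
have P2 : 0 < Pr p (predI [pred t' | (X t' == X t)] [pred t' | Q t' == Q t]).
  by rewrite (Pr_gt0 p0 pt)//= !eqxx.
have P3 : 0 < Pr p (predI [pred t' | (Y t' == Y t)] [pred t' | Q t' == Q t]).
  by rewrite (Pr_gt0 p0 pt)//= !eqxx.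
have P4 : 0 < Pr p [pred t' | Q t' == Q t] by rewrite (Pr_gt0 p0 pt)//=.
by rewrite /cond_info_ratio /cPr ln_cond_ratio.
Qed.

End Probability.

(** * Sparse weights *)

Section SparseWeights.
Variables (R : realFieldType) (V K : finType) (A : K -> V -> R).

(** With more points in [s] than moments, the rows of the moment matrix indexed by [s] are linearly
    dependent; [h] extends the coefficients of a dependence by 0. *)
Lemma exists_kernel (s : {set V}) : (#|K| < #|s|)%N ->
  exists h : V -> R, [/\ exists v, h v != 0, forall v, v \notin s -> h v = 0 &
    forall k, \sum_v h v * A k v = 0].
Proof.
move=> Ks; pose M := \matrix_(i < #|s|, k < #|K|) A (enum_val k) (enum_val i).
have : kermx M != 0.
  rewrite -mxrank_eq0 mxrank_ker subn_eq0 -ltnNge.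
  exact: leq_ltn_trans (rank_leq_col M) Ks.
case/rowV0Pn => u /sub_kermxP uM u0.
pose h v := \sum_i u 0 i *+ (enum_val i == v :> V).
have hE i : h (enum_val i) = u 0 i.
  rewrite /h (bigD1 i)//= eqxx mulr1n big1 ?addr0// => j ji.
  by rewrite (inj_eq enum_val_inj) (negbTE ji).
exists h; split.
- case/rV0Pn: u0 => i ui; exists (enum_val i); by rewrite hE.
- move=> v vs; rewrite /h big1// => i _; case: eqP => // iv.
  by rewrite -iv enum_valP in vs.
- move=> k; transitivity ((u *m M) 0 (enum_rank k)); last by rewrite uM mxE.
  rewrite mxE; under eq_bigr do rewrite mulr_suml.
  rewrite exchange_big/=; apply: eq_bigr => i _.
  rewrite (bigD1 (enum_val i))//= eqxx mulr1n big1 ?addr0 ?mxE ?enum_rankK//.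
  by move=> v; rewrite eq_sym => /negbTE ->; rewrite mulr0n mul0r.
Qed.

(* A basic optimal solution of the linear program minimizing [c] over the
   nonnegative weights with the same moments [A] as [t]; keeping [c] as the
   objective rather than as a constraint saves one point of support. *)
Lemma sparse_weights (c : V -> R) (a : K -> R) (t : V -> R) :
  (forall v, 0 <= t v) ->
  (forall v, t v != 0 -> 0 < \sum_k a k * A k v) ->
  exists t' : V -> R,
  [/\ forall v, 0 <= t' v,
      forall v, t v = 0 -> t' v = 0,
      (#|[set v | t' v != 0%R]| <= #|K|)%N,
      forall k, \sum_v t' v * A k v = \sum_v t v * A k v &
      \sum_v t' v * c v <= \sum_v t v * c v].
Proof.
move: {2}#|_| (leqnn #|[set v | t v != 0]|) => n.
elim: n t => [|n IH] t tn t0 tA; first by exists t; split=> //; rewrite (leq_trans tn).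
have [?|Kt] := leqP #|[set v | t v != 0]| #|K|; first by exists t; split.
(* A kernel vector on the support of [t], its sign chosen so that moving along it does not increase
   the cost. *)
have [h [hn0 hs hA hc]] : exists h : V -> R, [/\ exists v, h v != 0,
    forall v, t v = 0 -> h v = 0, forall k, \sum_v h v * A k v = 0 &
    \sum_v h v * c v <= 0].
  have [h [[v hv] hs hA]] := exists_kernel Kt.
  have {}hs w : t w = 0 -> h w = 0 by move=> tw; rewrite hs// inE tw eqxx.
  have [hc|hc] := leP (\sum_v h v * c v) 0; first by exists h; split=> //; exists v.
  exists (fun v => - h v); split.
  - by exists v; rewrite oppr_eq0.
  - by move=> w /hs ->; rewrite oppr0.
  - by move=> k; under eq_bigr do rewrite mulNr; rewrite sumrN hA oppr0.
  - by under eq_bigr do rewrite mulNr; rewrite sumrN oppr_le0 ltW.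
(* If [h] were nonnegative, pairing it with the combination of moments that is positive on the
   support would give 0 and force [h] to vanish. *)
have [v0 hv0] : exists v, h v < 0.
  apply: contrapT => /forallNP hneg.
  have h0 v : 0 <= h v by rewrite leNgt; apply/negP/hneg.
  have : \sum_v h v * (\sum_k a k * A k v) = 0.
    under eq_bigr do rewrite mulr_sumr.
    rewrite exchange_big big1//= => k _.
    under eq_bigr do rewrite mulrCA.
    by rewrite -mulr_sumr hA mulr0.
  have m0 v : 0 <= h v * (\sum_k a k * A k v).
    have [/hs ->|/tA/ltW ?] := eqVneq (t v) 0; first by rewrite mul0r.
    by rewrite mulr_ge0.
  move/eqP; rewrite psumr_eq0// => /allP sum0.
  case: hn0 => v hv; have := sum0 v (mem_index_enum v).
  rewrite /= mulf_eq0 (negbTE hv) gt_eqF//= tA//.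
  by apply: contraNneq hv => /hs ->.
(* Ratio test: [th] is the largest step along [h] that keeps the weights nonnegative, and the point
   [v1] attaining it leaves the support. *)
pose v1 := [arg min_(v < v0 | h v < 0) (t v / - h v)]%O.
have [hv1 v1min] : h v1 < 0 /\ forall v, h v < 0 -> t v1 / - h v1 <= t v / - h v.
  by rewrite /v1; case: Order.TotalTheory.arg_minP.
pose th := t v1 / - h v1.
have th0 : 0 <= th by rewrite divr_ge0 ?t0// oppr_ge0 ltW.
pose t1 v := t v + th * h v.
have t1v1 : t1 v1 = 0.
  by rewrite /t1 /th invrN mulrN mulNr divfK ?subrr// lt_eqF.
have t10 v : 0 <= t1 v.
  have [hv|hv] := leP 0 (h v); first by rewrite addr_ge0 ?t0// mulr_ge0.
  have := v1min v hv; rewrite ler_pdivlMr ?oppr_gt0// -/th mulrN /t1.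
  by rewrite lerNl -subr_ge0 opprK addrC.
have t1s v : t v = 0 -> t1 v = 0 by move=> tv; rewrite /t1 tv hs// mulr0 addr0.
have t1n : (#|[set v | t1 v != 0%R]| <= n)%N.
  rewrite -ltnS; apply: leq_trans tn; apply: proper_card; apply/properP; split.
    by apply/fintype.subsetP => v; rewrite !inE; apply: contraNneq => /t1s ->.
  exists v1; rewrite !inE ?t1v1 ?eqxx//.
  by apply: contraTneq hv1 => /hs ->; rewrite ltxx.
have t1E (b : V -> R) : \sum_v t1 v * b v = \sum_v t v * b v + th * \sum_v h v * b v.
  rewrite mulr_sumr -big_split/=; apply: eq_bigr => v _.
  by rewrite /t1 mulrDl mulrA.
have [|t2 [t20 t2s t2n t2A t2c]] := IH t1 t1n t10.
  by move=> v t1v; apply: tA; apply: contraNneq t1v => /t1s ->.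
exists t2; split=> //.
- by move=> v /t1s/t2s.
- by move=> k; rewrite t2A t1E hA mulr0 addr0.
- by rewrite (le_trans t2c)// t1E gerDl mulr_ge0_le0.
Qed.

End SparseWeights.

Lemma sum_neq0_ex (R : nmodType) (T : finType) (p : T -> R) :
  \sum_t p t != 0 -> exists t, p t != 0.
Proof.
move=> ps; apply: contrapT => /forallNP p0; move/eqP: ps; apply.
by apply: big1 => t _; apply/eqP/negPn/negP/p0.
Qed.

(** Elements are numbered by their position in the enumeration of [A]; the values of [f] outside [A]
    are arbitrary, which is harmless when [A] contains the support. *)
Lemma ord_retraction (T : finType) (A : {set T}) (t0 : T) (n : nat) :
  (#|A| <= n.+1)%N ->
  exists (f : T -> 'I_n.+1) (g : 'I_n.+1 -> T), {in A, cancel f g}.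
Proof.
move=> An; exists (fun t => inord (index t (enum A))).
exists (fun i => nth t0 (enum A) i) => t tA.
rewrite inordK ?nth_index ?mem_enum//.
by apply: leq_trans An; rewrite cardE index_mem mem_enum.
Qed.

(** * The single-letter law *)

Section LawMap.
Variables (R : realType) (T T' : finType).

Definition pmf_map (phi : T -> T') (p : T -> R) (t' : T') : R :=
  Pr p [pred t | phi t == t'].

Lemma Ex_pmf_map (phi : T -> T') (p : T -> R) (g : T' -> R) :
  Ex (pmf_map phi p) g = Ex p (g \o phi).
Proof. by rewrite (Ex_rv p phi g). Qed.

Lemma is_pmf_map (phi : T -> T') (p : T -> R) :
  is_pmf p -> is_pmf (pmf_map phi p).
Proof.
move=> [p0 p1]; split=> [t'|]; first exact: Pr_ge0.
transitivity (Ex (pmf_map phi p) (fun=> 1)).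
  by apply: eq_bigr => t' _; rewrite mulr1.
by rewrite Ex_pmf_map Ex_cst.
Qed.

Variables (p : T -> R) (p' : T' -> R) (phi : T -> T').
Hypothesis p'E : forall g, Ex p' g = Ex p (g \o phi).

Lemma Pr_map E : Pr p' E = Pr p [pred t | E (phi t)].
Proof. by rewrite !Pr_Ex p'E. Qed.

(** On the support of [p], [X] and [X'] after [phi] induce the same partition, and informations
    depend only on these partitions. *)
Definition same_kernel (A B : eqType) (X : T -> A) (X' : T' -> B) : Prop :=
  forall t1 t2, p t1 != 0 -> p t2 != 0 ->
  (X' (phi t1) == X' (phi t2)) = (X t1 == X t2).

Lemma same_kernel_pair (A B C D : eqType) (X : T -> A) (Y : T -> B)
    (X' : T' -> C) (Y' : T' -> D) : same_kernel X X' -> same_kernel Y Y' ->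
  same_kernel (fun t => (X t, Y t)) (fun t => (X' t, Y' t)).
Proof.
move=> hX hY t1 t2 p1 p2; rewrite -[LHS]/((_ == _) && (_ == _)) hX//.
by rewrite hY.
Qed.

Lemma mutual_info_map (A B C D : finType) (X : T -> A) (Y : T -> B)
    (X' : T' -> C) (Y' : T' -> D) : same_kernel X X' -> same_kernel Y Y' ->
  mutual_info p' X' Y' = mutual_info p X Y.
Proof.
move=> hX hY; rewrite !mutual_info_Ex p'E; apply: eq_Ex => t pt /=.
rewrite /info_ratio !Pr_map; congr (log2 (_ / (_ * _))); apply: eq_Pr => t' pt' /=;
by rewrite ?hX ?hY.
Qed.

Lemma cond_mutual_info_map (A B C D E F : finType) (X : T -> A) (Y : T -> B)
    (Q : T -> C) (X' : T' -> D) (Y' : T' -> E) (Q' : T' -> F) :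
  same_kernel X X' -> same_kernel Y Y' -> same_kernel Q Q' ->
  cond_mutual_info p' X' Y' Q' = cond_mutual_info p X Y Q.
Proof.
move=> hX hY hQ; rewrite !cond_mutual_info_Ex p'E; apply: eq_Ex => t pt /=.
rewrite /cond_info_ratio /cPr !Pr_map.
congr (log2 ((_ / _) / ((_ / _) * (_ / _)))); apply: eq_Pr => t' pt' /=;
by rewrite ?hX ?hY ?hQ.
Qed.

End LawMap.

(** Both sides equal the information computed under the common image law of [psi] and [psi']. *)
Lemma cond_mutual_info_factor (R : realType) (T T' T0 A B C : finType)
    (p : T -> R) (p' : T' -> R) (psi : T -> T0) (psi' : T' -> T0)
    (X : T0 -> A) (Y : T0 -> B) (Q : T0 -> C) :
  (forall g : T0 -> R, Ex p (g \o psi) = Ex p' (g \o psi')) ->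
  cond_mutual_info p (X \o psi) (Y \o psi) (Q \o psi) =
  cond_mutual_info p' (X \o psi') (Y \o psi') (Q \o psi').
Proof.
move=> pp'.
have p'E g : Ex (pmf_map psi p) g = Ex p' (g \o psi') by rewrite Ex_pmf_map pp'.
rewrite -(@cond_mutual_info_map _ _ _ _ _ _ (Ex_pmf_map psi p)
  _ _ _ _ _ _ (X \o psi) (Y \o psi) (Q \o psi) X Y Q)//.
by rewrite -(@cond_mutual_info_map _ _ _ _ _ _ p'E
  _ _ _ _ _ _ (X \o psi') (Y \o psi') (Q \o psi') X Y Q).
Qed.

Lemma cPr_mul (R : realType) (T : finType) (p : T -> R) (E F : pred T) :
  (forall t, 0 <= p t) -> cPr p E F * Pr p F = Pr p (predI E F).
Proof.
move=> p0; rewrite /cPr; have [F0|F0] := eqVneq (Pr p F) 0; last by rewrite divfK.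
rewrite F0 mulr0; apply/esym/eqP; rewrite eq_le Pr_ge0// andbT -F0 !Pr_Ex.
by apply: le_Ex => // t _ /=; case: (E t) => //=; rewrite ler0n.
Qed.

(** * Expectations, informations and costs under the single-letter law *)

Section Letter.
Variables (R : realType) (X S Y Z Sh : finType) (ch : isac_channel R X S Y Z Sh).

Lemma state_pmf_ge0 s : 0 <= state_pmf ch s.
Proof. by have [+ _] := state_pmfP ch; apply. Qed.

Lemma transition_ge0 x s yz : 0 <= transition ch x s yz.
Proof. by have [+ _] := transitionP ch x s; apply. Qed.

Lemma sum_transition x s : \sum_y \sum_z transition ch x s (y, z) = 1.
Proof.
by have [_] := transitionP ch x s; rewrite pair_bigA => <-; apply: eq_bigr => -[].
Qed.

(** This and [third_info] are the outer members of the minimum in [rate_bound]; for a trivial U the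
    middle one equals the first. *)
Definition first_info (U V : finType) (P : U * V * X -> R) : R :=
  cond_mutual_info (letter_law ch P) (@rvX X S Y Z U V) (@rvY X S Y Z U V)
    (@rvS X S Y Z U V).

Definition third_info (U V : finType) (P : U * V * X -> R) : R :=
  cond_mutual_info (letter_law ch P) (@rvX X S Y Z U V)
    (fun t => (rvY t, rvZ t)) (fun t => (rvU t, rvV t, rvS t)) +
  mutual_info (letter_law ch P) (fun t => (rvU t, rvV t)) (@rvZ X S Y Z U V).

Section Law.
Variables (U V : finType).
Implicit Types P : U * V * X -> R.

(** Conditional expectation of [g] given that (U, V, X) takes the value [w]. *)
Definition letter_mean (g : letter_space X S Y Z U V -> R) (w : U * V * X) : R :=
  \sum_s \sum_y \sum_z state_pmf ch s * transition ch w.2 s (y, z) *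
    g (w.1.1, w.1.2, s, w.2, y, z).

Lemma Ex_letter_law P g : Ex (letter_law ch P) g = Ex P (letter_mean g).
Proof.
pose h (q : (U * V * X) * (S * (Y * Z))) : letter_space X S Y Z U V :=
  (q.1.1.1, q.1.1.2, q.2.1, q.1.2, q.2.2.1, q.2.2.2).
have hbij : bijective h.
  exists (fun t => ((rvU t, rvV t, rvX t), (rvS t, (rvY t, rvZ t)))).
    by case=> [[[u v] x] [s [y z]]].
  by case=> [[[[[u v] s] x] y] z].
rewrite /Ex (reindex h)/=; last exact: onW_bij.
rewrite (eq_bigr (fun q => P q.1 * (state_pmf ch q.2.1 *
   transition ch q.1.2 q.2.1 q.2.2 * g (h q)))); last first.
  by move=> [[[u v] x] [s [y z]]] _ /=; rewrite !mulrA.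
rewrite -(pair_bigA _ (fun w r => P w * (state_pmf ch r.1 *
   transition ch w.2 r.1 r.2 * g (h (w, r)))))/=.
apply: eq_bigr => -[[u v] x] _; rewrite -mulr_sumr; congr (_ * _).
rewrite /letter_mean -(pair_bigA _ (fun s yz => state_pmf ch s *
   transition ch x s yz * g (h (u, v, x, (s, yz)))))/=.
by apply: eq_bigr => s _; rewrite pair_bigA; apply: eq_bigr => -[].
Qed.

Lemma letter_law_ge0 P : (forall w, 0 <= P w) -> forall t, 0 <= letter_law ch P t.
Proof.
move=> P0 [[[[[u v] s] x] y] z] /=.
by rewrite !mulr_ge0 ?state_pmf_ge0 ?transition_ge0.
Qed.

Lemma letter_mean_cst c w : letter_mean (fun=> c) w = c.
Proof.
rewrite /letter_mean; under eq_bigr do under eq_bigr do rewrite -mulr_suml -mulr_sumr.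
under eq_bigr do rewrite -mulr_suml -mulr_sumr sum_transition mulr1.
by rewrite -mulr_suml; have [_ ->] := state_pmfP ch; rewrite mul1r.
Qed.

Lemma is_pmf_letter_law P : is_pmf P -> is_pmf (letter_law ch P).
Proof.
move=> Ppmf; have [P0 P1] := Ppmf; split; first exact: letter_law_ge0.
transitivity (Ex (letter_law ch P) (fun=> 1)).
  by apply: eq_bigr => t _; rewrite mulr1.
rewrite Ex_letter_law (eq_Ex (g := fun=> 1)) ?Ex_cst// => w _.
exact: letter_mean_cst.
Qed.

Lemma letter_law_neq0 P t :
  letter_law ch P t != 0 -> P (rvU t, rvV t, rvX t) != 0.
Proof.
by case: t => [[[[[u v] s] x] y] z] /=; apply: contraNneq => ->; rewrite !mul0r.
Qed.

Definition estimator_cost P (sh : U -> V -> Z -> Sh) : R :=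
  Ex (letter_law ch P) (fun t => distortion ch (rvS t) (sh (rvU t) (rvV t) (rvZ t))).

Lemma estimator_costE P sh : (forall w, 0 <= P w) ->
  estimator_cost P sh = \sum_(w : U * V * Z)
    Pr (letter_law ch P) [pred t | [&& rvU t == w.1.1, rvV t == w.1.2 & rvZ t == w.2]] *
    posterior_cost ch P w.1.1 w.1.2 w.2 (sh w.1.1 w.1.2 w.2).
Proof.
move=> P0; rewrite /estimator_cost.
rewrite (Ex_rv _ (fun t => ((rvU t, rvV t, rvZ t), rvS t))
  (fun q => distortion ch q.2 (sh q.1.1.1 q.1.1.2 q.1.2))).
rewrite -(pair_bigA _ (fun w s => Pr (letter_law ch P)
   [pred t | ((rvU t, rvV t, rvZ t), rvS t) == (w, s)] *
   distortion ch s (sh w.1.1 w.1.2 w.2)))/=.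
apply: eq_bigr => -[[u v] z] _ /=; rewrite mulr_sumr; apply: eq_bigr => s _.
rewrite [RHS]mulrA [X in _ = X * _]mulrC cPr_mul; last exact: letter_law_ge0.
congr (_ * _); apply: eq_Pr => t _ /=.
by rewrite -[LHS]/(((_ == _) && (_ == _) && (_ == _)) && (_ == _)) andbC -andbA.
Qed.

(** The argmin minimizes each term of the cost decomposed over (u, v, z), so it does at least as
    well as any other estimator. Any estimator can thus serve as a witness of feasibility. *)
Lemma distortion_feasibleP P (D : R) : (forall w, 0 <= P w) ->
  distortion_feasible ch P D <-> exists sh, estimator_cost P sh <= D.
Proof.
move=> P0; split=> [[sh _ shD]|[sh shD]]; first by exists sh.
pose opt u v z := [arg min_(s' < sh u v z) posterior_cost ch P u v z s']%O.
have optP u v z s' : posterior_cost ch P u v z (opt u v z) <= posterior_cost ch P u v z s'.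
  by rewrite /opt; case: Order.TotalTheory.arg_minP => // s _; apply.
exists opt => //; apply: le_trans shD.
rewrite -/(estimator_cost P opt) !estimator_costE//; apply: ler_sum => -[[u v] z] _.
by rewrite ler_wpM2l// Pr_ge0//; exact: letter_law_ge0.
Qed.

Lemma estimator_cost_mean P sh : estimator_cost P sh =
  \sum_w P w * letter_mean (fun t => distortion ch (rvS t) (sh (rvU t) (rvV t) (rvZ t))) w.
Proof. exact: Ex_letter_law. Qed.

End Law.

(** * Relabelling of the auxiliary alphabets *)

Section Embedding.
Variables (U V U' V' : finType) (P : U * V * X -> R).
Variables (f : U -> U') (f' : U' -> U) (g : V -> V') (g' : V' -> V).
Hypothesis fK : forall w, P w != 0 -> f' (f w.1.1) = w.1.1.
Hypothesis gK : forall w, P w != 0 -> g' (g w.1.2) = w.1.2.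

Let phi (w : U * V * X) : U' * V' * X := (f w.1.1, g w.1.2, w.2).
Let psi (t : letter_space X S Y Z U V) : letter_space X S Y Z U' V' :=
  (f (rvU t), g (rvV t), rvS t, rvX t, rvY t, rvZ t).

(** The maps are inverted only on the support of [P]; this is enough because expectations and
    informations ignore null points. *)
Definition relabel := pmf_map phi P.

Lemma is_pmf_relabel : is_pmf P -> is_pmf relabel.
Proof. exact: is_pmf_map. Qed.

Lemma Ex_relabel h : Ex (letter_law ch relabel) h = Ex (letter_law ch P) (h \o psi).
Proof. by rewrite !Ex_letter_law Ex_pmf_map; apply: eq_Ex => -[[u v] x] _. Qed.

Lemma estimator_cost_relabel sh :
  estimator_cost relabel (fun u v z => sh (f' u) (g' v) z) = estimator_cost P sh.
Proof.
rewrite /estimator_cost Ex_relabel; apply: eq_Ex.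
move=> [[[[[u v] s] x] y] z] /letter_law_neq0 Pw /=.
by rewrite [f' _](fK Pw) [g' _](gK Pw).
Qed.

Lemma same_kernelU : same_kernel (letter_law ch P) psi (@rvU _ _ _ _ _ _) (@rvU _ _ _ _ _ _).
Proof.
move=> t1 t2 /letter_law_neq0/fK t1K /letter_law_neq0/fK t2K; rewrite /psi /=.
by apply/eqP/eqP => [e|->//]; rewrite -[LHS]t1K -[RHS]t2K/= e.
Qed.

Lemma same_kernelV : same_kernel (letter_law ch P) psi (@rvV _ _ _ _ _ _) (@rvV _ _ _ _ _ _).
Proof.
move=> t1 t2 /letter_law_neq0/gK t1K /letter_law_neq0/gK t2K; rewrite /psi /=.
by apply/eqP/eqP => [e|->//]; rewrite -[LHS]t1K -[RHS]t2K/= e.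
Qed.

Lemma first_info_relabel : first_info relabel = first_info P.
Proof. exact: (cond_mutual_info_map Ex_relabel). Qed.

Lemma third_info_relabel : third_info relabel = third_info P.
Proof.
have hUV := same_kernel_pair same_kernelU same_kernelV.
rewrite /third_info (mutual_info_map Ex_relabel hUV (Y := @rvZ _ _ _ _ _ _))//.
congr (_ + _); apply: (cond_mutual_info_map Ex_relabel) => //.
exact: (same_kernel_pair hUV (Y := @rvS _ _ _ _ _ _)).
Qed.

Lemma rate_bound_relabel : rate_bound ch relabel = rate_bound ch P.
Proof.
rewrite /rate_bound -!/(first_info _) -!/(third_info _).
rewrite first_info_relabel third_info_relabel.
rewrite (mutual_info_map Ex_relabel same_kernelU (Y := @rvZ _ _ _ _ _ _))//.
rewrite (cond_mutual_info_map Ex_relabel (X := @rvX _ _ _ _ _ _) (Y := @rvY _ _ _ _ _ _)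
  (Q := fun t => (rvU t, rvS t)))//.
exact: (same_kernel_pair same_kernelU (Y := @rvS _ _ _ _ _ _)).
Qed.

End Embedding.

(** When U is constant, I(U;Z) = 0 and conditioning on (U, S) amounts to conditioning on S, so the
    second member of the minimum repeats the first. *)
Lemma rate_bound_unit (V : finType) (P : unit * V * X -> R) : is_pmf P ->
  rate_bound ch P = Num.min (first_info P) (third_info P).
Proof.
move=> Ppmf; rewrite /rate_bound -/(first_info P) -/(third_info P).
have -> : cond_mutual_info (letter_law ch P) (@rvX X S Y Z unit V) (@rvY X S Y Z unit V)
    (fun t => (rvU t, rvS t)) = first_info P.
  exact: (@cond_mutual_info_map _ _ _ _ _ id).
have -> : mutual_info (letter_law ch P) (@rvU X S Y Z unit V) (@rvZ X S Y Z unit V) = 0.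
  have Lpmf := is_pmf_letter_law Ppmf; have [L0 _] := Lpmf.
  rewrite mutual_info_Ex -[RHS](Ex_cst _ Lpmf); apply: eq_Ex => t Lt.
  have tt1 u : rvU t == u by case: u; case: (rvU t).
  rewrite /info_ratio (eq_Pr (F := [pred t' | rvZ t' == rvZ t])); last first.
    by move=> t' _ /=; case: (rvU t'); case: (rvU t).
  rewrite [X in _ / (X * _)](_ : _ = 1); last first.
    rewrite Pr_Ex -[RHS](Ex_cst 1 Lpmf); apply: eq_Ex => t' _ /=.
    by case: (rvU t'); case: (rvU t).
  by rewrite mul1r divff ?(Pr_neq0 L0 Lt)//= /log2 ln1 mul0r.
by rewrite addr0 minA minxx.
Qed.
End Letter.

(** Equality when no factor is 0; otherwise the convention 1/0 = 0 makes the left side 0. The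
    changes of measure below can thus sum over null letters as well. *)
Lemma div_ratio_le (R : realFieldType) (a b k : R) : 0 <= b ->
  k / ((a * k) / (a * b)) <= b.
Proof.
move=> b0.
have [->|a0] := eqVneq a 0; first by rewrite !mul0r invr0 mulr0.
have [->|k0] := eqVneq k 0; first by rewrite mul0r.
have [->|b1] := eqVneq b 0; first by rewrite mulr0 invr0 mulr0 invr0 mulr0.
by rewrite le_eqVlt; apply/orP; left; apply/eqP; field; rewrite a0 b1 k0.
Qed.

(** * Information densities of the single-letter law *)

Section LetterRatios.
Variables (R : realType) (X S Y Z Sh : finType) (ch : isac_channel R X S Y Z Sh).
Variables (U V : finType) (P : U * V * X -> R).
Hypothesis P0 : forall w, 0 <= P w.
Let L := letter_law ch P.
Let L0 : forall t, 0 <= L t := letter_law_ge0 ch P0.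

Lemma Ex_letter_prod (a : U * V * X -> R) (b : S -> R) :
  Ex L (fun t => a (rvU t, rvV t, rvX t) * b (rvS t)) =
  Ex P a * \sum_s state_pmf ch s * b s.
Proof.
rewrite Ex_letter_law -ExMr; apply: eq_Ex => -[[u v] x] _; rewrite /letter_mean/=.
rewrite mulr_sumr; apply: eq_bigr => s _.
under eq_bigr do rewrite -mulr_suml -mulr_sumr.
by rewrite -mulr_suml -mulr_sumr sum_transition mulr1 mulrCA.
Qed.

Lemma Pr_letter_UVXS (E : pred (U * V * X)) s :
  Pr L [pred t | E (rvU t, rvV t, rvX t) && (rvS t == s)] =
  Pr P E * state_pmf ch s.
Proof.
transitivity (Ex L (fun t => (E (rvU t, rvV t, rvX t))%:R * (rvS t == s)%:R)).
  by rewrite Pr_Ex; apply: eq_Ex => t _ /=; rewrite -natrM mulnb.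
rewrite (Ex_letter_prod (fun w => (E w)%:R) (fun s' => (s' == s)%:R)) -Pr_Ex.
congr (_ * _); rewrite (bigD1 s)//= eqxx mulr1 big1 ?addr0// => s' /negbTE ->.
by rewrite mulr0.
Qed.

Lemma Pr_letter_UVX (E : pred (U * V * X)) :
  Pr L [pred t | E (rvU t, rvV t, rvX t)] = Pr P E.
Proof.
transitivity (Ex L (fun t => (E (rvU t, rvV t, rvX t))%:R * 1)).
  by rewrite Pr_Ex; apply: eq_Ex => t _ /=; rewrite mulr1.
rewrite (Ex_letter_prod (fun w => (E w)%:R) (fun=> 1)) -Pr_Ex.
under eq_bigr do rewrite mulr1.
by have [_ ->] := state_pmfP ch; rewrite mulr1.
Qed.

(** The event [E] fixes the input letter, so the channel contributes a single transition
    probability. *)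
Lemma Pr_letter_factor (E : pred (U * V * X)) x s y z :
  (forall w, E w -> w.2 = x) ->
  Pr L [pred t | E (rvU t, rvV t, rvX t) &&
    [&& rvS t == s, rvY t == y & rvZ t == z]] =
  Pr P E * state_pmf ch s * transition ch x s (y, z).
Proof.
move=> Ex_x; rewrite Pr_Ex Ex_letter_law (Pr_Ex P) -mulrA -ExMr.
apply: eq_Ex => -[[u v] x'] _; rewrite /letter_mean /=.
have [/Ex_x/= ->|_] := boolP (E _); last first.
  by rewrite mul0r; do !(apply: big1 => ? _); rewrite mulr0.
rewrite mul1r (bigD1 s)//= (bigD1 y)//= (bigD1 z)//= !eqxx mulr1.
rewrite big1 ?addr0; last by move=> z' /negbTE ->; rewrite mulr0.
rewrite big1 ?addr0; last first.
  by move=> y' /negbTE ->; apply: big1 => z' _; rewrite mulr0.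
rewrite big1 ?addr0// => s' /negbTE ->.
by do 2!(apply: big1 => ? _); rewrite mulr0.
Qed.

Definition first_ratio (x : X) (y : Y) (s : S) : R :=
  cond_info_ratio L (@rvX X S Y Z U V) (@rvY X S Y Z U V) (@rvS X S Y Z U V) x y s.

Definition third_ratio (uv : U * V) (x : X) (y : Y) (z : Z) (s : S) : R :=
  cond_info_ratio L (@rvX X S Y Z U V) (fun t => (rvY t, rvZ t))
    (fun t => (rvU t, rvV t, rvS t)) x (y, z) (uv, s) *
  info_ratio L (fun t => (rvU t, rvV t)) (@rvZ X S Y Z U V) uv z.

(** Apart from null letters the ratio is P(y|x,s) / P(y|s), so summing over z leaves P(s) P(y|s). *)
Lemma first_ratio_bound x y s :
  \sum_z (state_pmf ch s * transition ch x s (y, z)) / first_ratio x y s <=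
  state_pmf ch s * cPr L [pred t | rvY t == y] [pred t | rvS t == s].
Proof.
pose q := Pr L [pred t | rvS t == s].
pose a := cPr L [pred t | rvX t == x] [pred t | rvS t == s].
pose k := \sum_z transition ch x s (y, z).
have aE : a = Pr P [pred w | w.2 == x] * state_pmf ch s / q.
  by rewrite -Pr_letter_UVXS.
have -> : first_ratio x y s =
    (a * k) / (a * cPr L [pred t | rvY t == y] [pred t | rvS t == s]).
  rewrite /first_ratio /cond_info_ratio; congr (_ / (_ * _)).
  rewrite aE mulrAC; congr (_ / _); rewrite -(sum_Pr _ (@rvZ X S Y Z U V)) mulr_sumr.
  apply: eq_bigr => z _.
  rewrite -(@Pr_letter_factor [pred w | w.2 == x] x s y z) => [|w /eqP//].
  apply: eq_Pr => t _ /=.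
  by case: (_ == x); case: (_ == y); case: (_ == s); case: (_ == z).
rewrite -mulr_suml -mulr_sumr -/k -mulrA ler_wpM2l ?state_pmf_ge0//.
by apply: div_ratio_le; rewrite divr_ge0 ?Pr_ge0.
Qed.

(** Apart from null letters the ratio is P(y,z|x,s) P(uv,z) / (P(y,z|uv,s) P(uv) P(z)). Since (U, V)
    is independent of S, dividing by it turns P(s) P(y,z|x,s) into P(z) P(s,y|uv,z). *)
Lemma third_ratio_bound uv x y z s :
  (state_pmf ch s * transition ch x s (y, z)) / third_ratio uv x y z s <=
  Pr L [pred t | rvZ t == z] *
  cPr L [pred t | (rvS t, rvY t) == (s, y)] [pred t | ((rvU t, rvV t), rvZ t) == (uv, z)].
Proof.
pose G := [pred t : letter_space X S Y Z U V | (rvU t, rvV t, rvS t) == (uv, s)].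
pose F := [pred t : letter_space X S Y Z U V | (rvY t, rvZ t) == (y, z)].
pose a := cPr L [pred t | rvX t == x] G.
pose k := transition ch x s (y, z).
have GE : Pr L G = Pr L [pred t | (rvU t, rvV t) == uv] * state_pmf ch s.
  rewrite (@Pr_letter_UVX [pred w : U * V * X | w.1 == uv]).
  rewrite -Pr_letter_UVXS; apply: eq_Pr => t _.
  by rewrite -[LHS]/((_ == _) && (_ == _)).
have numE : cPr L [pred t | (rvX t == x) && ((rvY t, rvZ t) == (y, z))] G = a * k.
  rewrite /a /cPr mulrAC; congr (_ / _).
  transitivity (Pr P [pred w | (w.1 == uv) && (w.2 == x)] * state_pmf ch s * k).
    rewrite -Pr_letter_factor => [|w /andP[_ /eqP]//].
    apply: eq_Pr => t _ /=.
    rewrite -[(rvU t, rvV t, rvS t) == _]/((_ == _) && (_ == _)).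
    rewrite -[(rvY t, rvZ t) == _]/((_ == _) && (_ == _)).
    by case: (_ == uv); case: (_ == x); case: (_ == s); case: (_ == y); case: (_ == z).
  rewrite -Pr_letter_UVXS; congr (_ * _); apply: eq_Pr => t _ /=.
  rewrite -[(rvU t, rvV t, rvS t) == _]/((_ == _) && (_ == _)).
  by case: (_ == uv); case: (_ == x); case: (_ == s).
rewrite /third_ratio /cond_info_ratio /info_ratio -/G -/F -/a numE.
set b := cPr L F G.
set e := Pr L [pred t | ((rvU t, rvV t) == uv) && (rvZ t == z)].
set f := Pr L [pred t | (rvU t, rvV t) == uv]; set g := Pr L [pred t | rvZ t == z].
have e0 : 0 <= e by exact: Pr_ge0.
have f0 : 0 <= f by exact: Pr_ge0.
have g0 : 0 <= g by exact: Pr_ge0.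
have b0 : 0 <= b by rewrite divr_ge0 ?Pr_ge0.
apply: (@le_trans _ _ (state_pmf ch s * b * (f * g / e))).
  have -> : state_pmf ch s * k / (a * k / (a * b) * (e / (f * g))) =
      state_pmf ch s * (k / (a * k / (a * b))) * (f * g / e).
    by rewrite (invfM (a * k / (a * b))) (invf_div e) !mulrA.
  rewrite ler_wpM2r ?divr_ge0 ?mulr_ge0// ler_wpM2l ?state_pmf_ge0//.
  exact: div_ratio_le.
rewrite le_eqVlt; apply/orP; left; apply/eqP.
(* By independence [f * state_pmf ch s] is the probability of (uv, s); multiplied by [b] it becomes
   that of (uv, s, y, z). *)
have -> : state_pmf ch s * b * (f * g / e) = g * (b * (f * state_pmf ch s) / e) by ring.
rewrite -GE cPr_mul//; congr (_ * (_ / _)); apply: eq_Pr => t _ /=.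
rewrite -[(rvU t, rvV t, rvS t) == _]/((_ == _) && (_ == _)).
rewrite -[(rvU t, rvV t, rvZ t) == _]/((_ == _) && (_ == _)).
rewrite -[(rvY t, rvZ t) == _]/((_ == _) && (_ == _)).
rewrite -[(rvS t, rvY t) == _]/((_ == _) && (_ == _)).
by case: (_ == uv); case: (_ == s); case: (_ == y); case: (_ == z).
Qed.

Lemma third_ratio_gt0 t : L t != 0 ->
  0 < third_ratio (rvU t, rvV t) (rvX t) (rvY t) (rvZ t) (rvS t).
Proof.
move=> Lt; apply: mulr_gt0.
  exact: (cond_info_ratio_gt0 (@rvX _ _ _ _ _ _) (fun t => (rvY t, rvZ t))
    (fun t => (rvU t, rvV t, rvS t))).
exact: (info_ratio_gt0 (fun t => (rvU t, rvV t)) (@rvZ _ _ _ _ _ _)).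
Qed.

Lemma third_info_Ex : third_info ch P = Ex L (fun t =>
  log2 (third_ratio (rvU t, rvV t) (rvX t) (rvY t) (rvZ t) (rvS t))).
Proof.
rewrite /third_info cond_mutual_info_Ex mutual_info_Ex -ExD; apply: eq_Ex => t Lt.
rewrite /log2 -mulrDl -lnM// posrE.
  exact: (cond_info_ratio_gt0 (@rvX _ _ _ _ _ _) (fun t => (rvY t, rvZ t))
    (fun t => (rvU t, rvV t, rvS t))).
exact: (info_ratio_gt0 (fun t => (rvU t, rvV t)) (@rvZ _ _ _ _ _ _)).
Qed.

End LetterRatios.

(** * The converse at a fixed blocklength *)

Lemma ln_prod (R : realType) (I : finType) (F : I -> R) :
  (forall i, 0 < F i) -> ln (\prod_i F i) = \sum_i ln (F i).
Proof.
move=> F0; suff [] : 0 < \prod_i F i /\ ln (\prod_i F i) = \sum_i ln (F i) by [].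
apply: (big_ind2 (fun p q => 0 < p /\ ln p = q)) => [|x1 x2 y1 y2|i _].
- by rewrite ln1.
- by move=> [x0 <-] [y0 <-]; rewrite mulr_gt0// lnM.
- by [].
Qed.

Section Update.
Variables (n : nat) (T : finType).
Implicit Types (f : {ffun 'I_n -> T}) (i : 'I_n).

Definition upd f i b : {ffun 'I_n -> T} := [ffun j => if j == i then b else f j].

Lemma upd_same f i : upd f i (f i) = f.
Proof. by apply/ffunP => j; rewrite ffunE; case: eqP => [->|]. Qed.

Lemma upd_upd f i a b : upd (upd f i a) i b = upd f i b.
Proof. by apply/ffunP => j; rewrite !ffunE; case: eqP. Qed.

Lemma updE f i b : upd f i b i = b.
Proof. by rewrite ffunE eqxx. Qed.

Lemma upd_neq f i b j : j != i -> upd f i b j = f j.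
Proof. by rewrite ffunE => /negbTE ->. Qed.

End Update.

Section Converse.
Variables (R : realType) (X S Y Z Sh : finType) (ch : isac_channel R X S Y Z Sh).
Variables (M n : nat) (c : isac_code X S Y Z Sh M n) (z0 : Z).
Hypotheses (M0 : (0 < M)%N) (n0 : (0 < n)%N).

Let law := code_law ch c.
Let Seq : finType := ({ffun 'I_n -> S} * {ffun 'I_n -> Y} * {ffun 'I_n -> Z})%type.

Definition letter_density (x : X) (a : S * Y * Z) : R :=
  state_pmf ch a.1.1 * transition ch x a.1.1 (a.1.2, a.2).

Definition letter_at (q : Seq) (i : 'I_n) : S * Y * Z := (q.1.1 i, q.1.2 i, q.2 i).

Definition block_density (w : 'I_M) (q : Seq) : R :=
  \prod_i letter_density (encoder c w i) (letter_at q i).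

Lemma sum_letter_density x : \sum_a letter_density x a = 1.
Proof.
have [_ <-] := state_pmfP ch.
rewrite -(pair_bigA _ (fun sy z => letter_density x (sy, z)))/=.
rewrite -(pair_bigA _ (fun s y => \sum_z letter_density x (s, y, z)))/=.
apply: eq_bigr => s _; rewrite /letter_density/=.
under eq_bigr do rewrite -mulr_sumr.
by rewrite -mulr_sumr sum_transition mulr1.
Qed.

Lemma letter_density_ge0 x a : 0 <= letter_density x a.
Proof. by rewrite mulr_ge0 ?state_pmf_ge0 ?transition_ge0. Qed.

Lemma sum_code_space (F : code_space S Y Z M n -> R) :
  \sum_t F t = \sum_w \sum_(q : Seq) F (w, q.1.1, q.1.2, q.2).
Proof.
rewrite pair_bigA.
rewrite (reindex (fun p : 'I_M * Seq => (p.1, p.2.1.1, p.2.1.2, p.2.2)))//=.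
apply: onW_bij; exists (fun t => (t.1.1.1, (t.1.1.2, t.1.2, t.2))).
  by case=> w [[s y] z].
by case=> [[[w s] y] z].
Qed.

Lemma code_lawE w (q : Seq) :
  law (w, q.1.1, q.1.2, q.2) = M%:R^-1 * block_density w q.
Proof. by rewrite /law /code_law -mulrA -big_split. Qed.

Lemma code_law_ge0 t : 0 <= law t.
Proof.
case: t => [[[w s] y] z]; rewrite (code_lawE w (s, y, z)).
by rewrite mulr_ge0 ?invr_ge0// prodr_ge0// => i _; exact: letter_density_ge0.
Qed.

Lemma sum_Seq (F : Seq -> R) : \sum_q F q = \sum_s \sum_y \sum_z F (s, y, z).
Proof.
by rewrite pair_bigA pair_bigA; apply: eq_bigr => -[[s y] z] _.
Qed.

Lemma sum_prod_Seq2 (K : 'I_n -> S -> Y -> R) :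
  \sum_(s : {ffun 'I_n -> S}) \sum_(y : {ffun 'I_n -> Y}) \prod_i K i (s i) (y i) =
  \prod_i \sum_s \sum_y K i s y.
Proof.
rewrite bigA_distr_bigA; apply: eq_bigr => s _.
by rewrite -(bigA_distr_bigA (fun i y => K i (s i) y)).
Qed.

Lemma sum_block_density w : \sum_q block_density w q = 1.
Proof.
rewrite sum_Seq; under eq_bigr => s _ do under eq_bigr => y _ do
  rewrite -(bigA_distr_bigA (fun i z => letter_density (encoder c w i) (s i, y i, z))).
rewrite (sum_prod_Seq2 (fun i s y => \sum_z letter_density (encoder c w i) (s, y, z))).
apply: big1 => i _; rewrite -[RHS](sum_letter_density (encoder c w i)).
by rewrite pair_bigA pair_bigA; apply: eq_bigr => -[[s y] z] _.
Qed.

Lemma is_pmf_code_law : is_pmf law.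
Proof.
split; first exact: code_law_ge0.
rewrite sum_code_space; under eq_bigr => w _.
  under eq_bigr do rewrite code_lawE.
  rewrite -mulr_sumr sum_block_density mulr1; over.
by rewrite sumr_const card_ord -(mulr_natl M%:R^-1) divff// pnatr_eq0 -lt0n.
Qed.

(* Exchanging the [i]-th letter with a fresh independent copy leaves the
   product law invariant. *)
Lemma resample w i (F : {ffun 'I_n -> Z} -> S * Y * Z -> R) :
  (forall z b a, F (upd z i b) a = F z a) ->
  \sum_(q : Seq) block_density w q *
    \sum_a letter_density (encoder c w i) a * F q.2 a =
  \sum_(q : Seq) block_density w q * F q.2 (letter_at q i).
Proof.
move=> Fupd; set d := letter_density (encoder c w i).
pose put (q : Seq) (a : S * Y * Z) : Seq :=
  (upd q.1.1 i a.1.1, upd q.1.2 i a.1.2, upd q.2 i a.2).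
have putK q a : put (put q a) (letter_at q i) = q.
  by case: q => [[s y] z]; rewrite /put /= !upd_upd !upd_same.
have at_put q a : letter_at (put q a) i = a.
  by case: a => [[s y] z]; rewrite /letter_at /= !updE.
have dput q a : block_density w (put q a) * d (letter_at q i) =
    block_density w q * d a.
  rewrite /block_density (bigD1 i)//= [in RHS](bigD1 i)//= at_put -/d.
  under eq_bigr => j ji do rewrite /letter_at /put /= !upd_neq//.
  by rewrite -!/(letter_at q _) -/d; ring.
transitivity (\sum_(q : Seq) \sum_a block_density w q * d a * F q.2 a).
  by apply: eq_bigr => q _; rewrite mulr_sumr; apply: eq_bigr => a _; rewrite mulrA.
rewrite pair_bigA/=.
(* The exchange of letters is an involution on pairs of a block and a fresh letter. *)
rewrite (reindex (fun p : Seq * (S * Y * Z) => (put p.1 p.2, letter_at p.1 i)))/=; last first.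
  apply: onW_bij; exists (fun p => (put p.1 p.2, letter_at p.1 i)) => -[q a] /=;
  by rewrite putK at_put.
rewrite -(pair_bigA _ (fun q a => block_density w (put q a) * d (letter_at q i) *
   F (put q a).2 (letter_at q i)))/=.
apply: eq_bigr => q _; rewrite -[in RHS](mulr1 (block_density w q)).
rewrite -(sum_letter_density (encoder c w i)) mulr_sumr mulr_suml.
by apply: eq_bigr => a _; rewrite dput Fupd.
Qed.

Definition side_info : finType := ('I_n * {ffun 'I_n -> Z})%type.

(* The auxiliary variable consists of the time index [i] and of the sensing
   output with its [i]-th letter erased, i.e., overwritten by [z0]. *)
Definition block_letter (i : 'I_n) (t : code_space S Y Z M n) :
    letter_space X S Y Z unit side_info :=
  let: (w, s, y, z) := t in (tt, (i, upd z i z0), s i, encoder c w i, y i, z i).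

(** The mixture over [i] with weights 1/n realizes a uniform time index independent of the code
    sequences. *)
Definition block_input (w : unit * side_info * X) : R :=
  n%:R^-1 * \sum_i Pr law [pred t |
    (rvU (block_letter i t), rvV (block_letter i t), rvX (block_letter i t)) == w].

Lemma block_input_ge0 w : 0 <= block_input w.
Proof.
rewrite mulr_ge0 ?invr_ge0//; apply: sumr_ge0 => i _.
by apply: Pr_ge0; exact: code_law_ge0.
Qed.

Lemma Ex_block_input g : Ex block_input g = n%:R^-1 * \sum_i
  Ex law (fun t => g (rvU (block_letter i t), rvV (block_letter i t), rvX (block_letter i t))).
Proof.
rewrite /Ex /block_input; under eq_bigr do rewrite -mulrA mulr_suml.
rewrite -mulr_sumr exchange_big/=; congr (_ * _); apply: eq_bigr => i _.
by rewrite -[RHS]/(Ex law _)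
  (Ex_rv law (fun t => (rvU (block_letter i t), rvV (block_letter i t), rvX (block_letter i t))) g).
Qed.

Lemma is_pmf_block_input : is_pmf block_input.
Proof.
split; first exact: block_input_ge0.
transitivity (Ex block_input (fun=> 1)).
  by apply: eq_bigr => t' _; rewrite mulr1.
rewrite Ex_block_input; under eq_bigr do rewrite (Ex_cst _ is_pmf_code_law).
by rewrite sumr_const card_ord mulVf// pnatr_eq0 -lt0n.
Qed.

(** The erased letter does not enter V, so by [resample] the letters at time [i] may be drawn afresh
    given V and X. The time-averaged letter of the code therefore follows the single-letter law
    exactly. *)
Lemma Ex_block_letter g : Ex (letter_law ch block_input) g =
  n%:R^-1 * \sum_i Ex law (g \o block_letter i).
Proof.
rewrite Ex_letter_law Ex_block_input; congr (_ * _); apply: eq_bigr => i _.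
rewrite /Ex !sum_code_space; apply: eq_bigr => w _.
under eq_bigr do rewrite code_lawE -mulrA.
under [in RHS]eq_bigr do rewrite code_lawE -mulrA.
rewrite -!mulr_sumr; congr (_ * _).
pose F (z : {ffun 'I_n -> Z}) (a : S * Y * Z) : R :=
  g (tt, (i, upd z i z0), a.1.1, encoder c w i, a.1.2, a.2).
rewrite -[RHS](@resample w i F); last by move=> z b a; rewrite /F upd_upd.
apply: eq_bigr => q _; congr (_ * _); rewrite /letter_mean/=.
by rewrite pair_bigA pair_bigA; apply: eq_bigr => -[[s y] z] _.
Qed.

(** A density positive on the support of the single-letter law is thereby positive at every letter
    of every code sequence of positive probability. *)
Lemma block_letter_neq0 t i : law t != 0 ->
  letter_law ch block_input (block_letter i t) != 0.
Proof.
move=> lt; have n1 : 0 < n%:R^-1 :> R by rewrite invr_gt0 ltr0n.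
suff : 0 < Pr (letter_law ch block_input) (pred1 (block_letter i t)).
  by rewrite /Pr big_pred1_eq => /gt_eqF ->.
rewrite Pr_Ex Ex_block_letter mulr_gt0//.
rewrite (bigD1 i)//= ltr_pwDl//; last first.
  by apply: sumr_ge0 => j _; rewrite -[X in _ <= X]Pr_Ex Pr_ge0//; exact: code_law_ge0.
rewrite -[X in _ < X](Pr_Ex law (fun t' => block_letter i t' == block_letter i t)).
by apply: (Pr_gt0 (t := t)) => //=; exact: code_law_ge0.
Qed.

(* Guess the decoder's output or a uniform message, with probability 1/2
   each: the cost of this guess plays the role of Fano's inequality. *)
Definition guess (w : 'I_M) (s : {ffun 'I_n -> S}) (y : {ffun 'I_n -> Y}) : R :=
  ((decoder c y s == w)%:R + M%:R^-1) / 2.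

Lemma sum_guess s y : \sum_w guess w s y = 1.
Proof.
rewrite /guess -mulr_suml big_split/= sumr_const card_ord -(mulr_natl M%:R^-1).
rewrite divff ?pnatr_eq0 -?lt0n// (bigD1 (decoder c y s))//= eqxx big1; last first.
  by move=> w; rewrite eq_sym => /negbTE ->.
by rewrite addr0 divff.
Qed.

Lemma guess_gt0 w s y : 0 < guess w s y.
Proof. by rewrite divr_gt0// ltr_wpDl// invr_gt0 ltr0n. Qed.

(** A correct decision makes the guess at least 1/2; after an error only the uniform part 1/(2M)
    remains. *)
Lemma ln_guess w s y : - ln 2 - (decoder c y s != w)%:R * ln M%:R <= ln (guess w s y).
Proof.
have Mp : 0 < M%:R :> R by rewrite ltr0n.
rewrite /guess ln_div ?posrE ?ltr_wpDl ?invr_gt0// addrC lerD2r.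
case: eqP => _ /=; rewrite ?mul0r ?oppr0 ?mul1r.
  by rewrite ln_ge0// lerDl invr_ge0 ltW.
by rewrite add0r lnV.
Qed.

(** The second hypothesis says that a reweighted code law has mass at most 1, so the mean logarithm
    of its density is nonpositive; expanding this logarithm gives the bound. The final 1 is the bit
    paid for the fair coin in [guess]. *)
Lemma one_shot_converse (r : letter_space X S Y Z unit side_info -> R) :
  (forall t, letter_law ch block_input t != 0 -> 0 < r t) ->
  \sum_w \sum_(q : Seq) guess w q.1.1 q.1.2 *
    (block_density w q / \prod_i r (block_letter i (w, q.1.1, q.1.2, q.2))) <= 1 ->
  (1 - error_probability ch c) * log2 M%:R <=
  n%:R * Ex (letter_law ch block_input) (fun t => log2 (r t)) + 1.
Proof.
move=> r0 sub.
have Mp : 0 < M%:R :> R by rewrite ltr0n.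
have l2 : 0 < ln 2 :> R by rewrite ln_gt0// ltr1n.
(* Density of the reweighted law with respect to [law]; the factor [M] cancels the probability 1/M
   of the message. *)
pose rho (t : code_space S Y Z M n) : R :=
  let: (w, s, y, z) := t in
  guess w s y * M%:R / \prod_i r (block_letter i t).
have rP t : law t != 0 -> 0 < \prod_i r (block_letter i t).
  by move=> lt; apply: prodr_gt0 => i _; apply/r0/block_letter_neq0.
have Erho : Ex law rho <= 1.
  apply: le_trans sub; rewrite /Ex sum_code_space le_eqVlt; apply/orP; left; apply/eqP.
  apply: eq_bigr => w _; apply: eq_bigr => q _; rewrite code_lawE /rho.
  set p := (\prod_i _)^-1; have -> : M%:R^-1 * block_density w q *
    (guess w q.1.1 q.1.2 * M%:R * p) =
    (M%:R^-1 * M%:R) * (guess w q.1.1 q.1.2 * (block_density w q * p)) by ring.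
  by rewrite mulVf ?gt_eqF// mul1r.
have rho0 t : law t != 0 -> 0 < rho t.
  move=> lt; have := rP t lt; case: t lt => [[[w s] y] z] _ rt.
  by rewrite /rho (divr_gt0 (mulr_gt0 (guess_gt0 w s y) Mp)).
(* Jensen's inequality in the form ln x <= x - 1. *)
have lnrho : Ex law (fun t => ln (rho t)) <= 0.
  apply: (@le_trans _ _ (Ex law (fun t => rho t - 1))); last first.
    by rewrite ExB (Ex_cst _ is_pmf_code_law) subr_le0.
  apply: le_Ex => [|t /rho0 rt]; first exact: code_law_ge0.
  have := @le_ln1Dx _ (rho t - 1); rewrite (addrC 1) subrK; apply.
  by rewrite ltrBrDl subrr.
pose err (t : code_space S Y Z M n) : bool :=
  let: (w, s, y, z) := t in decoder c y s != w.
have : Ex law (fun t => (ln M%:R - ln 2) -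
    ((err t)%:R * ln M%:R +
     \sum_i ln (r (block_letter i t)))) <= 0.
  apply: le_trans lnrho; apply: le_Ex => [|t lt]; first exact: code_law_ge0.
  have rt := rP t lt.
  have lnprod := ln_prod (fun i => r0 _ (block_letter_neq0 i lt)).
  case: t lt rt lnprod => [[[w s] y] z] lt rt lnprod; rewrite /rho.
  have g0 := guess_gt0 w s y.
  rewrite ln_div ?posrE ?(mulr_gt0 g0 Mp)// lnM ?posrE// lnprod.
  have := ln_guess w s y; lra.
have errE : Ex law (fun t => (err t)%:R) = error_probability ch c.
  by rewrite /error_probability Pr_Ex.
rewrite ExB (Ex_cst _ is_pmf_code_law) ExD ExMr errE Ex_sum.
rewrite /log2 ExMr Ex_block_letter => h.
have nr : n%:R != 0 :> R by rewrite pnatr_eq0 -lt0n.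
set A := \sum_i _ in h *; rewrite [X in X <= _]mulrA ler_pdivrMr// [X in _ <= X]mulrDl mul1r.
have -> : n%:R * (n%:R^-1 * A / ln 2) * ln 2 = A by field; rewrite nr gt_eqF.
move: h; lra.
Qed.

End Converse.

(** * The two rate bounds and the distortion of a code *)

Section TwoBounds.
Variables (R : realType) (X S Y Z Sh : finType) (ch : isac_channel R X S Y Z Sh).

Lemma cond_info_ratio_ge0 (T A B C : finType) (p : T -> R) (f : T -> A) (g : T -> B)
    (h : T -> C) a b c : (forall t, 0 <= p t) -> 0 <= cond_info_ratio p f g h a b c.
Proof. by move=> p0; rewrite !(divr_ge0, mulr_ge0) ?Pr_ge0. Qed.

Lemma info_ratio_ge0 (T A B : finType) (p : T -> R) (f : T -> A) (g : T -> B) a b :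
  (forall t, 0 <= p t) -> 0 <= info_ratio p f g a b.
Proof. by move=> p0; rewrite !(divr_ge0, mulr_ge0) ?Pr_ge0. Qed.

Lemma prod_le1 (I : finType) (F : I -> R) :
  (forall i, 0 <= F i <= 1) -> \prod_i F i <= 1.
Proof.
by move=> F01; rewrite -[leRHS](big1_eq (op := *%R) (idx := 1) (index_enum I) xpredT)
  ler_prod.
Qed.

Variables (M n : nat) (c : isac_code X S Y Z Sh M n) (z0 : Z).
Hypotheses (M0 : (0 < M)%N) (n0 : (0 < n)%N).
Let P := block_input ch c z0.
Let P0 : forall w, 0 <= P w := block_input_ge0 ch c z0.
Let L0 : forall t, 0 <= letter_law ch P t := letter_law_ge0 ch P0.

(** Summing out z^n letter by letter leaves the product of the P(s_i) P(y_i|s_i), so that the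
    message occurs only in the guess. *)
Lemma first_converse :
  (1 - error_probability ch c) * log2 M%:R <= n%:R * first_info ch P + 1.
Proof.
rewrite /first_info cond_mutual_info_Ex.
apply: (@one_shot_converse _ _ _ _ _ _ ch _ _ c z0 M0 n0
  (fun t => first_ratio ch P (rvX t) (rvY t) (rvS t))).
  by move=> t; exact: cond_info_ratio_gt0.
pose K s y := state_pmf ch s *
  cPr (letter_law ch P) [pred t | rvY t == y] [pred t | rvS t == s].
apply: (@le_trans _ _ (\sum_w \sum_(s : {ffun 'I_n -> S}) \sum_(y : {ffun 'I_n -> Y})
    guess R c w s y * \prod_i K (s i) (y i))).
  apply: ler_sum => w _; rewrite sum_Seq; apply: ler_sum => s _; apply: ler_sum => y _ /=.
  rewrite -mulr_sumr ler_wpM2l//; first exact/ltW/guess_gt0.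
  rewrite (eq_bigr (fun z : {ffun 'I_n -> Z} => \prod_i
    (letter_density ch (encoder c w i) (s i, y i, z i) /
     first_ratio ch P (encoder c w i) (y i) (s i)))); last first.
    by move=> z _; rewrite [RHS]prodf_div.
  rewrite -(bigA_distr_bigA (fun i z => letter_density ch (encoder c w i) (s i, y i, z) /
    first_ratio ch P (encoder c w i) (y i) (s i))).
  apply: ler_prod => i _; rewrite first_ratio_bound// andbT; apply: sumr_ge0 => z _.
  by rewrite divr_ge0 ?letter_density_ge0// cond_info_ratio_ge0.
(* With the sum over messages innermost, the guess sums to 1. *)
rewrite exchange_big/=; under eq_bigr do rewrite exchange_big/=.
under eq_bigr do under eq_bigr do rewrite -mulr_suml sum_guess// mul1r.
rewrite (sum_prod_Seq2 (fun=> K)); apply: prod_le1 => i; apply/andP; split.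
  by do 2!(apply: sumr_ge0 => ? _); rewrite mulr_ge0 ?state_pmf_ge0// divr_ge0 ?Pr_ge0.
have [_ <-] := state_pmfP ch; apply: ler_sum => s _.
by rewrite -mulr_sumr ler_piMr ?state_pmf_ge0// sum_cPr_le1.
Qed.

(** For fixed z^n every v_i is determined, so the factors P(s_i,y_i|v_i,z_i) can be summed over s^n
    and y^n before the P(z_i) are summed. *)
Lemma third_converse :
  (1 - error_probability ch c) * log2 M%:R <= n%:R * third_info ch P + 1.
Proof.
pose r (t : letter_space X S Y Z unit (side_info Z n)) :=
  third_ratio ch P (rvU t, rvV t) (rvX t) (rvY t) (rvZ t) (rvS t).
rewrite third_info_Ex//.
apply: one_shot_converse => // [t Lt|].
  exact: third_ratio_gt0.
pose g z := Pr (letter_law ch P) [pred t | rvZ t == z].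
pose K (z : {ffun 'I_n -> Z}) i s y := cPr (letter_law ch P)
  [pred t | (rvS t, rvY t) == (s, y)]
  [pred t | ((rvU t, rvV t), rvZ t) == ((tt, (i, upd z i z0)), z i)].
apply: (@le_trans _ _ (\sum_w \sum_(s : {ffun 'I_n -> S}) \sum_(y : {ffun 'I_n -> Y})
   \sum_(z : {ffun 'I_n -> Z})
    guess R c w s y * \prod_i (g (z i) * K z i (s i) (y i)))).
  apply: ler_sum => w _; rewrite sum_Seq; apply: ler_sum => s _; apply: ler_sum => y _ /=.
  apply: ler_sum => z _; rewrite ler_wpM2l//; first exact/ltW/guess_gt0.
  rewrite /block_density -prodf_div; apply: ler_prod => i _; apply/andP; split.
    rewrite divr_ge0 ?letter_density_ge0// mulr_ge0//.
      exact: cond_info_ratio_ge0.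
    exact: info_ratio_ge0.
  exact: third_ratio_bound.
(* The sums are reordered so that the guess sums to 1 first and z^n comes outermost. *)
rewrite exchange_big/=; under eq_bigr do rewrite exchange_big/=.
under eq_bigr do under eq_bigr do rewrite exchange_big/=.
under eq_bigr do under eq_bigr do under eq_bigr do rewrite -mulr_suml sum_guess// mul1r.
under eq_bigr do rewrite exchange_big/=.
rewrite exchange_big/=.
apply: (@le_trans _ _ (\sum_(z : {ffun 'I_n -> Z}) \prod_i g (z i))).
  apply: ler_sum => z _.
  under eq_bigr do under eq_bigr do rewrite big_split/=.
  under eq_bigr do rewrite -mulr_sumr.
  rewrite -mulr_sumr (sum_prod_Seq2 (K z)) ler_piMr//.
    by apply: prodr_ge0 => i _; exact: Pr_ge0.
  apply: prod_le1 => i; apply/andP; split.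
    by do 2!(apply: sumr_ge0 => ? _); rewrite divr_ge0 ?Pr_ge0.
  rewrite pair_bigA/=; apply: le_trans (sum_cPr_le1 (fun t => (rvS t, rvY t)) _ L0).
  by rewrite le_eqVlt; apply/orP; left; apply/eqP; apply: eq_bigr => -[].
rewrite -(bigA_distr_bigA (fun i z => g z)); apply: prod_le1 => i.
have -> : \sum_z g z = 1.
  transitivity (Ex (letter_law ch P) (fun=> 1)).
    by rewrite (Ex_rv _ (@rvZ _ _ _ _ _ _) (fun=> 1)); apply: eq_bigr => z _; rewrite mulr1.
  by rewrite Ex_cst//; apply: is_pmf_letter_law; exact: is_pmf_block_input.
by rewrite ler01 lexx.
Qed.

(** V holds the time index and the erased outputs; writing Z back at that index restores z^n, to
    which the estimator of the code applies. *)
Lemma block_estimator : exists sh, estimator_cost ch P sh = average_distortion ch c.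
Proof.
exists (fun _ v z => estimator c (upd v.2 v.1 z) v.1).
rewrite /estimator_cost Ex_block_letter// /average_distortion; congr (_ * _).
apply: eq_bigr => i _; apply: eq_bigr => -[[[w s] y] z] _ /=.
by rewrite upd_upd upd_same.
Qed.

End TwoBounds.

(** * Cardinality of the auxiliary variable *)

Section SideInfoReduction.
Variables (R : realType) (X S Y Z Sh : finType) (ch : isac_channel R X S Y Z Sh).
Variables (V : finType) (P : unit * V * X -> R).
Hypothesis Ppmf : is_pmf P.
Let P0 : forall w, 0 <= P w. Proof. by case: Ppmf. Qed.
Let L := letter_law ch P.

Lemma sum_unit_side (F : unit * V * X -> R) : \sum_w F w = \sum_v \sum_x F (tt, v, x).
Proof.
rewrite pair_bigA/= (reindex (fun p : V * X => (tt, p.1, p.2)))//=.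
by apply: onW_bij; exists (fun w => (w.1.2, w.2)) => [[]|[[[]]]].
Qed.

(** Unnormalized contribution of the value [v] to the expectation of [g]; expectations become linear
    in weights on V. *)
Definition at_side (g : letter_space X S Y Z unit V -> R) (v : V) : R :=
  \sum_(t | rvV t == v) L t * g t.

Lemma sum_at_side g : \sum_v at_side g v = Ex L g.
Proof. by rewrite /Ex (partition_big (@rvV X S Y Z unit V) xpredT). Qed.

Lemma at_side_eq0 g v : \sum_x P (tt, v, x) = 0 -> at_side g v = 0.
Proof.
move=> Pv; apply: big1 => t /eqP tv; have [->|] := eqVneq (L t) 0; first by rewrite mul0r.
move=> /letter_law_neq0; rewrite tv; case: (rvU t) => Px.
move/eqP: Pv; rewrite psumr_eq0// => /allP/(_ (rvX t) (mem_index_enum _))/=.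
by rewrite (negbTE Px).
Qed.

Section Scaling.
Variable t : V -> R.
Hypothesis t0 : forall v, 0 <= t v.
Hypothesis tP : forall x, \sum_v t v * P (tt, v, x) = \sum_v P (tt, v, x).

(** Reweights the values of V without altering the law of X given each of them; [tP] keeps the
    overall law of X. *)
Definition scale (w : unit * V * X) : R := t w.1.2 * P w.
Let Lt := letter_law ch scale.

Lemma scale_ge0 w : 0 <= scale w.
Proof. by rewrite mulr_ge0. Qed.

Lemma sum_scale (G : X -> R) : \sum_w scale w * G w.2 = \sum_w P w * G w.2.
Proof.
rewrite !sum_unit_side exchange_big [RHS]exchange_big/=; apply: eq_bigr => x _.
by rewrite -!mulr_suml tP.
Qed.

Lemma is_pmf_scale : is_pmf scale.
Proof.
split; first exact: scale_ge0.
have [_ <-] := Ppmf; have := sum_scale (fun=> 1).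
by under eq_bigr do rewrite mulr1; under [in RHS]eq_bigr do rewrite mulr1.
Qed.

Lemma scale_law q : Lt q = t (rvV q) * L q.
Proof. by case: q => [[[[[u v] s] x] y] z]; rewrite /Lt /L /= /scale/= !mulrA. Qed.

Lemma Ex_scale g : Ex Lt g = \sum_v t v * at_side g v.
Proof.
rewrite /Ex (partition_big (@rvV X S Y Z unit V) xpredT)//=; apply: eq_bigr => v _.
rewrite mulr_sumr; apply: eq_bigr => q /eqP qv.
by rewrite scale_law qv mulrA.
Qed.

(** The law of (S, X, Y, Z) depends on the input law only through that of X, which [tP]
    preserves. *)
Lemma Ex_scale_factor (g : S * X * Y * Z -> R) :
  let psi q := (rvS q, rvX q, rvY q, rvZ q) in Ex L (g \o psi) = Ex Lt (g \o psi).
Proof.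
rewrite /L /Lt !Ex_letter_law; apply: esym.
exact: (sum_scale (fun x => \sum_s \sum_y \sum_z
  state_pmf ch s * transition ch x s (y, z) * g (s, x, y, z))).
Qed.

Lemma first_info_scale : first_info ch scale = first_info ch P.
Proof.
apply/esym; exact: (cond_mutual_info_factor (fun q => q.1.1.2) (fun q => q.1.2)
  (fun q => q.1.1.1) Ex_scale_factor).
Qed.

Lemma Pr_scale_side v (E : pred (letter_space X S Y Z unit V)) :
  (forall q, E q -> rvV q = v) -> Pr Lt E = t v * Pr L E.
Proof.
by move=> Ev; rewrite mulr_sumr; apply: eq_bigr => q /Ev qv; rewrite scale_law qv.
Qed.

Lemma cPr_scale_side v (E F : pred (letter_space X S Y Z unit V)) :
  t v != 0 -> (forall q, F q -> rvV q = v) -> cPr Lt E F = cPr L E F.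
Proof.
move=> tv Fv; rewrite /cPr (Pr_scale_side Fv) (@Pr_scale_side v (predI E F)).
  by rewrite invfM mulrACA divff// mul1r.
by move=> q /andP[_ /Fv].
Qed.

(* The information density is homogeneous of degree 0 in the weight of each
   value of the auxiliary variable. *)
Lemma third_ratio_scale v x y z s : t v != 0 ->
  third_ratio ch scale (tt, v) x y z s = third_ratio ch P (tt, v) x y z s.
Proof.
move=> tv; rewrite /third_ratio /cond_info_ratio /info_ratio -/L -/Lt.
rewrite !(cPr_scale_side _ tv); try by move=> q /eqP[].
rewrite (@Pr_scale_side v [pred q | ((rvU q, rvV q) == (tt, v)) && (rvZ q == z)]); last first.
  by move=> q /andP[/eqP[]].
rewrite (@Pr_scale_side v [pred q | ((rvU q, rvV q) == (tt, v))]); last by move=> q /eqP[].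
have -> : Pr Lt [pred q | rvZ q == z] = Pr L [pred q | rvZ q == z].
  by rewrite !Pr_Ex; apply/esym; exact: (Ex_scale_factor (fun q => (q.2 == z)%:R)).
have cancel_weight (a b e : R) : t v * a / (t v * b * e) = a / (b * e).
  by rewrite -(mulrA (t v) b e) invfM mulrACA divff// mul1r.
by rewrite cancel_weight.
Qed.

Definition third_density (q : letter_space X S Y Z unit V) : R :=
  log2 (third_ratio ch P (rvU q, rvV q) (rvX q) (rvY q) (rvZ q) (rvS q)).

Lemma third_info_scale : third_info ch scale = \sum_v t v * at_side third_density v.
Proof.
rewrite third_info_Ex -?Ex_scale; last exact: scale_ge0.
apply: eq_Ex => q; rewrite -/Lt scale_law mulf_eq0 negb_or => /andP[tq _].
by rewrite /third_density; case: (rvU q); rewrite third_ratio_scale.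
Qed.

End Scaling.

(** The probabilities of the letters of X and the third information are |X| + 1 linear functionals
    of the weights on V, whence the alphabet size. The law of X fixes the total mass and the first
    information; the cost of the given estimator is the objective. *)
Lemma reduce_side_info (sh : unit -> V -> Z -> Sh) :
  exists (P' : unit * 'I_(#|X|.+1) * X -> R) sh',
  [/\ is_pmf P', first_info ch P' = first_info ch P,
      third_info ch P' = third_info ch P &
      estimator_cost ch P' sh' <= estimator_cost ch P sh].
Proof.
have [w0 _] : exists w, P w != 0.
  by apply: sum_neq0_ex; case: Ppmf => _ ->; exact: oner_neq0.
pose cost (q : letter_space X S Y Z unit V) : R :=
  distortion ch (rvS q) (sh (rvU q) (rvV q) (rvZ q)).
pose A (k : option X) v := if k is Some x then P (tt, v, x) else at_side third_density v.
(* Initial weights 1, except 0 at the null values of V, where all moments vanish. *)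
pose t0 v : R := (\sum_x P (tt, v, x) != 0)%:R.
have t0E (F : V -> R) : (forall v, \sum_x P (tt, v, x) = 0 -> F v = 0) ->
    \sum_v t0 v * F v = \sum_v F v.
  move=> F0; apply: eq_bigr => v _; rewrite /t0.
  by case: eqP => [/F0 ->|_] /=; rewrite ?mulr0 ?mul1r.
have t00 v : 0 <= t0 v by exact: ler0n.
(* With coefficient 1 on the letters of X and 0 on the information, the combination of moments is
   the probability of [v], positive where [t0] is not 0. *)
have [|t [tp _ tn tA tc]] := @sparse_weights R V (option X) A (at_side cost)
    (fun k => (k != None)%:R) t0 t00.
  move=> v; rewrite /t0 pnatr_eq0 eqb0 negbK => Pv.
  have [x Px] := sum_neq0_ex Pv.
  rewrite (bigD1 (Some x))//= mul1r ltr_pwDl ?lt0r ?Px ?P0//.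
  by apply: sumr_ge0 => -[x'|] _ /=; rewrite ?mul0r ?mul1r.
have tP x : \sum_v t v * P (tt, v, x) = \sum_v P (tt, v, x).
  rewrite (tA (Some x)) t0E// => v /eqP; rewrite psumr_eq0// => /allP.
  by move=> /(_ x (mem_index_enum _))/eqP.
pose Pt := scale t.
have Ptpmf : is_pmf Pt := is_pmf_scale tp tP.
have [f [g fK]] := ord_retraction (w0.1.2) (leq_trans tn (eq_leq (card_option X))).
have idK (w : unit * V * X) : Pt w != 0 -> (id : unit -> unit) (id w.1.1) = w.1.1 by [].
have gK (w : unit * V * X) : Pt w != 0 -> g (f w.1.2) = w.1.2.
  by move=> Pw; apply: fK; rewrite inE; apply: contraNneq Pw => tw; rewrite /Pt /scale tw mul0r.
exists (relabel Pt id f); exists (fun u v z => sh u (g v) z); split.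
- exact: is_pmf_relabel.
- by rewrite first_info_relabel first_info_scale.
- rewrite (@third_info_relabel _ _ _ _ _ _ ch _ _ _ _ Pt id id f g idK gK).
  rewrite third_info_scale// (tA None) t0E.
    by rewrite sum_at_side third_info_Ex.
  by move=> v; exact: at_side_eq0.
- rewrite (@estimator_cost_relabel _ _ _ _ _ _ ch _ _ _ _ Pt id id f g idK gK).
  rewrite /estimator_cost Ex_scale (le_trans tc)//.
  by rewrite t0E ?sum_at_side// => v; exact: at_side_eq0.
Qed.

End SideInfoReduction.

(** * Continuity and compactness *)

Section XLnX.
Local Open Scope classical_set_scope.
Variable R : realType.

Definition xlnx (x : R) : R := x * ln x.

(** The bound tends to 0 at 0 and so gives continuity there. Its main case 0 < x < 1 comes from ln u
    < u at u = 1 / sqrt x. *)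
Lemma xlnx_bound (x : R) : `|xlnx x| <= 2 * Num.sqrt x + x ^+ 2.
Proof.
have s0 : 0 <= Num.sqrt x by exact: sqrtr_ge0.
have x2 : 0 <= x ^+ 2 by exact: sqr_ge0.
rewrite /xlnx; have [x0|x0] := leP x 0.
  by rewrite ln0// mulr0 normr0; lra.
have [x1|x1] := leP 1 x.
  rewrite ger0_norm ?mulr_ge0 ?ln_ge0 ?(ltW x0)// expr2.
  have : x * ln x <= x * x by rewrite ler_wpM2l ?(ltW x0)// (ltW (ln_sublinear x0)).
  lra.
have sx : 0 < Num.sqrt x by rewrite sqrtr_gt0.
have xE : Num.sqrt x ^+ 2 = x by rewrite sqr_sqrtr// ltW.
have lnx : - ln x = 2 * ln (Num.sqrt x)^-1.
  by rewrite -[in LHS]xE lnXn// lnV ?posrE// mulr2n; lra.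
have lnle : ln (Num.sqrt x)^-1 <= (Num.sqrt x)^-1 by rewrite ltW// ln_sublinear// invr_gt0.
rewrite ler0_norm ?mulr_ge0_le0 ?(ltW x0) ?ln_le0 ?(ltW x1)// -mulrN lnx.
apply: (@le_trans _ _ (x * (2 * (Num.sqrt x)^-1))).
  by rewrite ler_wpM2l ?(ltW x0)// ler_wpM2l.
have -> : x * (2 * (Num.sqrt x)^-1) = 2 * Num.sqrt x.
  by rewrite -[X in X * _ = _]xE expr2; field; rewrite gt_eqF.
lra.
Qed.

Lemma xlnx_continuous : continuous xlnx.
Proof.
move=> x; have [x0|x0|->] := ltgtP x 0.
- rewrite /continuous_at {2}/xlnx ln0 ?(ltW x0)// mulr0; apply: cvg_near_cst.
  near=> y; rewrite /xlnx ln0 ?mulr0// ltW//; near: y.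
  exact: lt_nbhsl.
- apply: cvgM; [exact: cvg_id | exact: continuous_ln].
- rewrite /continuous_at {2}/xlnx mul0r; apply/norm_cvg0P.
  apply: (@squeeze_cvgr _ _ _ _ (fun=> 0) (fun x => 2 * Num.sqrt x + x ^+ 2)).
  + by near=> y; rewrite normr_ge0 xlnx_bound.
  + exact: cvg_cst.
  + rewrite [X in _ --> X](_ : _ = 2 * Num.sqrt 0 + 0 ^+ 2); last first.
      by rewrite sqrtr0 mulr0 expr2 mulr0 addr0.
    apply: cvgD; first by apply: cvgM; [exact: cvg_cst | exact: sqrt_continuous].
    by apply: cvgM; exact: cvg_id.
Unshelve. all: by end_near. Qed.

End XLnX.

Section ContinuousReal.
Local Open Scope classical_set_scope.
Variables (R : realType) (T : topologicalType).
Implicit Types f g : T -> R.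

Lemma add_fct_continuous f g :
  continuous f -> continuous g -> continuous (fun x => f x + g x).
Proof. by move=> fc gc x; exact: (continuousD (fc x) (gc x)). Qed.

Lemma sub_fct_continuous f g :
  continuous f -> continuous g -> continuous (fun x => f x - g x).
Proof. by move=> fc gc x; exact: (continuousB (fc x) (gc x)). Qed.

Lemma mul_cst_continuous f (a : R) : continuous f -> continuous (fun x => f x * a).
Proof. by move=> fc x; apply: cvgM; [exact: fc | exact: cvg_cst]. Qed.

Lemma min_fct_continuous f g :
  continuous f -> continuous g -> continuous (fun x => Num.min (f x) (g x)).
Proof. by move=> fc gc x; exact: (continuous_min (fc x) (gc x)). Qed.

Lemma max_fct_continuous f g :
  continuous f -> continuous g -> continuous (fun x => Num.max (f x) (g x)).
Proof. by move=> fc gc x; exact: (continuous_max (fc x) (gc x)). Qed.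

Lemma comp_fct_continuous f (h : R -> R) :
  continuous f -> continuous h -> continuous (fun x => h (f x)).
Proof. by move=> fc hc x; apply: continuous_comp; [exact: fc | exact: hc]. Qed.

Lemma sum_continuous (J : finType) (F : J -> T -> R) :
  (forall j, continuous (F j)) -> continuous (fun x => \sum_j F j x).
Proof.
move=> Fc; apply: (continuous_big (op := +%R)) => [|j _]; last exact: Fc.
by move=> x; exact: add_continuous.
Qed.

Lemma bigmin_fct_continuous (J : Type) (s : seq J) f (F : J -> T -> R) :
  continuous f -> (forall j, continuous (F j)) ->
  continuous (fun x => \big[Num.min/f x]_(j <- s) F j x).
Proof.
move=> fc Fc; elim: s => [|j s IH]; first by under eq_fun do rewrite big_nil.
by under eq_fun do rewrite big_cons; exact: min_fct_continuous.
Qed.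

Lemma closed_fct_le f (a : R) : continuous f -> closed [set x | f x <= a].
Proof. by move=> fc; apply: (preimage_closed (D := [set y | y <= a])). Qed.

Lemma closed_fct_ge f (a : R) : continuous f -> closed [set x | a <= f x].
Proof. by move=> fc; apply: (preimage_closed (D := [set y | a <= y])). Qed.

Lemma closed_fct_eq f (a : R) : continuous f -> closed [set x | f x = a].
Proof. by move=> fc; apply: (preimage_closed (D := [set y | y = a])). Qed.

End ContinuousReal.

(** * Compactness of the probability simplex *)

Section PmfSpace.
Local Open Scope classical_set_scope.
Variables (R : realType) (I : finType).
Lemma ptws_eval_continuous (i : I) : continuous (fun p : {ptws I -> R} => p i).
Proof. exact: (@proj_continuous I (fun=> R) i). Qed.

Lemma linear_continuous (a : I -> R) :
  continuous (fun p : {ptws I -> R} => \sum_i p i * a i).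
Proof.
apply: (@sum_continuous R {ptws I -> R} I (fun i p => p i * a i)) => i.
exact/(@mul_cst_continuous R {ptws I -> R})/ptws_eval_continuous.
Qed.

(** A closed subset of a cube, which is compact by Tychonoff's theorem. *)
Lemma compact_pmf : compact [set p : {ptws I -> R} | is_pmf p].
Proof.
have c01 : compact [set p : {ptws I -> R} | forall i, `[(0 : R), 1]%classic (p i)].
  exact: (@tychonoff I (fun=> R : topologicalType) (fun=> `[(0 : R), 1]%classic)
    (fun=> @segment_compact _ _ _)).
apply: (subclosed_compact _ c01) => [|p [p0 p1] i].
  rewrite (_ : mkset _ = (\bigcap_i [set p : {ptws I -> R} | 0 <= p i]) `&`
      [set p : {ptws I -> R} | \sum_i p i * 1 = 1]); last first.
    have sum1 (p : I -> R) : \sum_i p i * 1 = \sum_i p i.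
      by apply: eq_bigr => i _; rewrite mulr1.
    apply/seteqP; split=> p /= [p0 p1]; split.
    - by move=> i _; exact: p0.
    - by rewrite sum1.
    - by move=> i; exact: p0.
    - by rewrite -sum1.
  apply: closedI.
    apply: closed_bigI => i _; apply: (@closed_fct_ge R {ptws I -> R}).
    exact: ptws_eval_continuous.
  exact/(@closed_fct_eq R {ptws I -> R})/linear_continuous.
rewrite /= in_itv/= p0 -p1 (bigD1 i)//= lerDl; exact: sumr_ge0.
Qed.

End PmfSpace.

(** * Continuity of the single-letter quantities and extreme values *)

Section Continuity.
Local Open Scope classical_set_scope.
Variables (R : realType) (X S Y Z Sh : finType) (ch : isac_channel R X S Y Z Sh).
Variables (U V : finType).
Let PT := {ptws (U * V * X) -> R}.

Lemma Ex_letter_continuous g : continuous (fun P : PT => Ex (letter_law ch P) g).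
Proof.
rewrite (_ : (fun P : PT => _) = fun P : PT => \sum_w P w * letter_mean ch g w).
  exact: linear_continuous.
by apply/funext => P; exact: Ex_letter_law.
Qed.

Lemma neg_entropy_continuous (A : finType) (f : letter_space X S Y Z U V -> A) :
  continuous (fun P : PT => neg_entropy (letter_law ch P) f).
Proof.
apply: (@sum_continuous R PT A
  (fun a P => xlnx (Pr (letter_law ch P) [pred t | f t == a]))) => a.
apply: (@comp_fct_continuous R PT); last exact: xlnx_continuous.
rewrite (_ : (fun P : PT => _) =
  fun P : PT => Ex (letter_law ch P) (fun t => (f t == a)%:R)).
  exact: Ex_letter_continuous.
by apply/funext => Q; rewrite /= Pr_Ex.
Qed.

(** The entropy formula is continuous on all weights but is identified with the information for
    nonnegative ones; hence a continuous [F] that agrees with it on pmfs. *)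
Lemma mutual_info_continuous (A B : finType) (f : letter_space X S Y Z U V -> A)
   (g : letter_space X S Y Z U V -> B) : exists F : PT -> R, continuous F /\
  forall P, is_pmf P -> F P = mutual_info (letter_law ch P) f g.
Proof.
exists (fun P : PT => (neg_entropy (letter_law ch P) (fun t => (f t, g t)) -
  neg_entropy (letter_law ch P) f - neg_entropy (letter_law ch P) g) / ln 2).
split; last by move=> P [P0 _]; rewrite mutual_infoE//; exact: letter_law_ge0.
apply: (@mul_cst_continuous R PT).
by do 2?[apply: (@sub_fct_continuous R PT)]; exact: neg_entropy_continuous.
Qed.

Lemma cond_mutual_info_continuous (A B C : finType) (f : letter_space X S Y Z U V -> A)
   (g : letter_space X S Y Z U V -> B) (h : letter_space X S Y Z U V -> C) :
  exists F : PT -> R, continuous F /\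
  forall P, is_pmf P -> F P = cond_mutual_info (letter_law ch P) f g h.
Proof.
exists (fun P : PT => (neg_entropy (letter_law ch P) (fun t => (f t, g t, h t)) +
  neg_entropy (letter_law ch P) h - neg_entropy (letter_law ch P) (fun t => (f t, h t)) -
  neg_entropy (letter_law ch P) (fun t => (g t, h t))) / ln 2).
split; last by move=> P [P0 _]; rewrite cond_mutual_infoE//; exact: letter_law_ge0.
apply: (@mul_cst_continuous R PT).
do 2?[apply: (@sub_fct_continuous R PT)]; try exact: neg_entropy_continuous.
by apply: (@add_fct_continuous R PT); exact: neg_entropy_continuous.
Qed.

Lemma rate_bound_continuous : exists F : PT -> R, continuous F /\
  forall P, is_pmf P -> F P = rate_bound ch P.
Proof.
have [F1 [F1c F1E]] :=
  cond_mutual_info_continuous (@rvX _ _ _ _ _ _) (@rvY _ _ _ _ _ _) (@rvS _ _ _ _ _ _).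
have [F2 [F2c F2E]] :=
  cond_mutual_info_continuous (@rvX _ _ _ _ _ _) (@rvY _ _ _ _ _ _) (fun t => (rvU t, rvS t)).
have [F3 [F3c F3E]] := mutual_info_continuous (@rvU _ _ _ _ _ _) (@rvZ _ _ _ _ _ _).
have [F4 [F4c F4E]] := cond_mutual_info_continuous (@rvX _ _ _ _ _ _) (fun t => (rvY t, rvZ t))
  (fun t => (rvU t, rvV t, rvS t)).
have [F5 [F5c F5E]] := mutual_info_continuous (fun t => (rvU t, rvV t)) (@rvZ _ _ _ _ _ _).
exists (fun P => Num.min (F1 P) (Num.min (F2 P + F3 P) (F4 P + F5 P))); split.
  apply: (@min_fct_continuous R PT) => //.
  by apply: (@min_fct_continuous R PT); exact: (@add_fct_continuous R PT).
by move=> P Ppmf; rewrite F1E// F2E// F3E// F4E// F5E.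
Qed.

(** There are finitely many estimators and each has a linear cost, so the least cost is continuous;
    [sh0] only starts the iterated minimum. *)
Lemma min_cost_continuous (sh0 : U -> V -> Z -> Sh) : exists F : PT -> R, continuous F /\
  forall P D, F P <= D <-> exists sh, estimator_cost ch P sh <= D.
Proof.
exists (fun P => \big[Num.min/estimator_cost ch P sh0]_(sh : {ffun U * V * Z -> Sh})
  estimator_cost ch P (fun u v z => sh (u, v, z))); split.
  apply: (@bigmin_fct_continuous R PT _ (index_enum {ffun U * V * Z -> Sh})
    (fun P => estimator_cost ch P sh0)
    (fun sh P => estimator_cost ch P (fun u v z => sh (u, v, z)))) => [|sh];
  exact: Ex_letter_continuous.
move=> P D; split=> [/bigmin_leP[shD|[sh _ shD]]|[sh shD]]; first by exists sh0.
  by exists (fun u v z => sh (u, v, z)).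
apply/bigmin_leP; right; exists [ffun w : U * V * Z => sh w.1.1 w.1.2 w.2] => //.
by rewrite /estimator_cost; under eq_Ex do rewrite ffunE/=.
Qed.

(** The feasible pmfs form a closed subset of the simplex, on which the continuous rate bound
    attains its maximum. *)
Lemma rate_bound_max (D : R) :
  (exists P : U * V * X -> R, is_pmf P /\ distortion_feasible ch P D) ->
  exists P : U * V * X -> R, [/\ is_pmf P, distortion_feasible ch P D &
    forall P' : U * V * X -> R, is_pmf P' -> distortion_feasible ch P' D ->
    rate_bound ch P' <= rate_bound ch P].
Proof.
move=> [P1 [P1pmf [sh0 _ sh0D]]].
have [F [Fc FE]] := rate_bound_continuous.
have [G [Gc GE]] := min_cost_continuous sh0.
have feasP (P : PT) : is_pmf P -> distortion_feasible ch P D <-> G P <= D.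
  by move=> [P0 _]; rewrite distortion_feasibleP// GE.
have Kc : compact ([set P : PT | is_pmf P] `&` [set P : PT | G P <= D]).
  apply: compact_closedI; first exact: compact_pmf.
  exact: (@closed_fct_le R PT).
have [] := compact_EVT_max _ Kc (continuous_subspaceT Fc).
  by exists P1; split=> //=; apply/GE; exists sh0.
move=> P; rewrite inE => -[/= Ppmf PD] Pmax; exists P; split=> //; first exact/feasP.
move=> P' P'pmf P'D; rewrite -!FE//; apply: Pmax; rewrite inE; split=> //=.
exact/feasP.
Qed.

(** The larger violation [H] of the two constraints attains its minimum on the simplex, and this
    minimum is at most every positive [e]; this replaces the extraction of a convergent
    subsequence. *)
Lemma rate_bound_limit (r D : R) (sh0 : U -> V -> Z -> Sh) :
  (forall e, 0 < e -> exists (P : U * V * X -> R) sh,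
    [/\ is_pmf P, r - e <= rate_bound ch P & estimator_cost ch P sh <= D + e]) ->
  exists P : U * V * X -> R, [/\ is_pmf P, distortion_feasible ch P D &
    r <= rate_bound ch P].
Proof.
move=> approx.
have [F [Fc FE]] := rate_bound_continuous.
have [G [Gc GE]] := min_cost_continuous sh0.
pose H (P : PT) := Num.max (r - F P) (G P - D).
have Hc : continuous H.
  by apply: (@max_fct_continuous R PT); apply: (@sub_fct_continuous R PT) => //;
    exact: cst_continuous.
have [] := compact_EVT_min _ (@compact_pmf R (U * V * X)%type) (continuous_subspaceT Hc).
  by have [P [_ [Ppmf _ _]]] := approx 1 ltr01; exists P.
move=> P; rewrite inE => /= Ppmf Pmin.
have : H P <= 0.
  apply/ler_addgt0Pl => e e0; rewrite addr0.
  have [P' [sh [P'pmf P'r P'D]]] := approx e e0.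
  apply: (@le_trans _ _ (H P')); first by apply: Pmin; rewrite inE.
  rewrite ge_max FE// lerBlDr addrC -lerBlDr P'r/= lerBlDr addrC.
  by apply/GE; exists sh.
rewrite ge_max FE// !subr_le0 => /andP[rP GD]; exists P; split=> //.
by apply/distortion_feasibleP; [case: Ppmf|exact/GE].
Qed.

End Continuity.

(** * The capacity-distortion bound *)

Lemma num_messages_gt0 (R : realType) (r : R) n : (0 < num_messages r n)%N.
Proof.
have c0 : 0 < Num.ceil (2 `^ (n%:R * r)) by rewrite ceil_gt_int powR_gt0.
by rewrite /num_messages absz_gt0 gt_eqF.
Qed.

Lemma log2_num_messages (R : realType) (r : R) n :
  n%:R * r <= log2 (num_messages r n)%:R.
Proof.
have l2 : 0 < ln 2 :> R by rewrite ln_gt0// ltr1n.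
rewrite /log2 ler_pdivlMr// -ln_powR ler_ln ?posrE ?powR_gt0//; last first.
  by rewrite ltr0n num_messages_gt0.
rewrite /num_messages natr_absz ger0_norm ?ceil_ge// ltW//.
by rewrite ceil_gt_int powR_gt0.
Qed.

Lemma limn_esup_le_near (R : realType) (u : nat -> R) (D e : R) :
  (limn_esup (fun n => (u n)%:E) <= D%:E)%E -> 0 < e ->
  (\forall n \near \oo, u n < D + e)%classic.
Proof.
move=> uD e0; have : (limn_esup (fun n => (u n)%:E) < (D + e)%:E)%E.
  by apply: le_lt_trans uD _; rewrite lte_fin ltrDl.
rewrite /limn_esup limf_esupE => /ereal_inf_lt[_ [A Aoo <-] AD].
apply: filterS Aoo => n An; rewrite -lte_fin; apply: le_lt_trans AD.
by apply: ereal_sup_ubound; exists n.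
Qed.

Section Bound.
Variables (R : realType) (X S Y Z Sh : finType) (ch : isac_channel R X S Y Z Sh).

(** All admissible alphabets embed into one fixed pair, so the maximum can be sought in a single
    compact space. *)
Lemma relabel_ordinals (U V : finType) (P : U * V * X -> R) (D : R) (a b : nat) :
  (#|U| <= a.+1)%N -> (#|V| <= b.+1)%N -> is_pmf P -> distortion_feasible ch P D ->
  exists P' : 'I_a.+1 * 'I_b.+1 * X -> R,
  [/\ is_pmf P', distortion_feasible ch P' D & rate_bound ch P' = rate_bound ch P].
Proof.
move=> Ua Vb Ppmf; have [P0 P1] := Ppmf.
have [[[u0 v0] _] _] : exists w, P w != 0.
  by apply: sum_neq0_ex; rewrite P1 oner_neq0.
have [f [f' fK]] : exists (f : U -> 'I_a.+1) (g : 'I_a.+1 -> U), {in [set: U], cancel f g}.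
  by apply: (ord_retraction u0); rewrite cardsT.
have [g [g' gK]] : exists (f : V -> 'I_b.+1) (g : 'I_b.+1 -> V), {in [set: V], cancel f g}.
  by apply: (ord_retraction v0); rewrite cardsT.
have fK' w : P w != 0 -> f' (f w.1.1) = w.1.1 by move=> _; rewrite fK ?inE.
have gK' w : P w != 0 -> g' (g w.1.2) = w.1.2 by move=> _; rewrite gK ?inE.
move=> /(distortion_feasibleP _ _ P0)[sh shD].
have Rpmf := is_pmf_relabel f g Ppmf.
exists (relabel P f g); split=> //.
  apply/distortion_feasibleP; first by case: Rpmf.
  exists (fun u v z => sh (f' u) (g' v) z).
  by rewrite (estimator_cost_relabel ch fK' gK').
exact: (rate_bound_relabel ch fK' gK').
Qed.

(** The cost is linear in the input law, so a deterministic input does as well as any, and only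
    finitely many pairs of a letter and an estimator remain. *)
Lemma feasible_of_Dmin (D : R) : (Dmin ch <= D%:E)%E ->
  exists P : unit * unit * X -> R, is_pmf P /\ distortion_feasible ch P D.
Proof.
pose e x (sh : {ffun Z -> Sh}) : R := letter_mean ch
  (fun t : letter_space X S Y Z unit unit => distortion ch (rvS t) (sh (rvZ t))) (tt, tt, x).
have [[x [sh xD]] _|] := pselect (exists x sh, e x sh <= D).
  pose P (w : unit * unit * X) : R := (w == (tt, tt, x))%:R.
  have ExP g : Ex P g = g (tt, tt, x).
    rewrite /Ex (bigD1 (tt, tt, x))//= /P eqxx mul1r big1 ?addr0// => w /negbTE ->.
    by rewrite mul0r.
  exists P; split.
    split=> [w|]; first exact: ler0n.
    by rewrite -[RHS](ExP (fun=> 1)); apply: eq_bigr => w _; rewrite mulr1.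
  apply/distortion_feasibleP => [w|]; first exact: ler0n.
  by exists (fun _ _ => sh); rewrite estimator_cost_mean -/(Ex P _) ExP.
move=> noD; rewrite leNgt => /negP; case.
(* If no pair meets [D], the least of their costs exceeds [D] and bounds every value in [Dmin] from
   below; the default [D + 1] covers the absence of pairs. *)
pose m := \big[Num.min/D + 1]_(q : X * {ffun Z -> Sh}) e q.1 q.2.
apply: (@lt_le_trans _ _ m%:E).
  rewrite lte_fin /m; apply: lt_bigmin => [|[x sh] _ /=]; first by rewrite ltrDl.
  by rewrite ltNge; apply/negP => xD; apply: noD; exists x, sh.
apply: le_ereal_inf_tmp => _ [_ [PX [sh [PXpmf ->]]] <-]; rewrite lee_fin.
have [PX0 PX1] := PXpmf.
pose sh' := [ffun z => sh z].
rewrite [leRHS](_ : _ = \sum_x PX x * e x sh').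
  rewrite -[leLHS]mul1r -PX1 mulr_suml; apply: ler_sum => x _.
  by rewrite ler_wpM2l// /m; exact: (bigmin_le _ (x, sh')).
transitivity (\sum_x \sum_s \sum_(yz : Y * Z)
    PX x * state_pmf ch s * transition ch x s yz * distortion ch s (sh yz.2)).
  by rewrite !pair_bigA; apply: eq_bigr => -[[x s] [y z]] _.
apply: eq_bigr => x _; rewrite /e /letter_mean mulr_sumr; apply: eq_bigr => s _.
rewrite pair_bigA mulr_sumr; apply: eq_bigr => -[y z] _ /=.
by rewrite ffunE !mulrA.
Qed.

(** The reduction of V makes its alphabet independent of the blocklength, so the laws obtained from
    all codes lie in one simplex and the limit can be taken there. *)
Lemma achievable_rate_bound (r D : R) (z0 : Z) (s0 : Sh) : 0 <= r -> achievable ch r D ->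
  exists P : unit * 'I_(#|X|.+1) * X -> R,
  [/\ is_pmf P, distortion_feasible ch P D & r <= rate_bound ch P].
Proof.
move=> r0 [c [Pe0 cD]]; apply: (rate_bound_limit (fun _ _ _ => s0)) => e e0.
have e2 : 0 < e / 2 by rewrite divr_gt0.
(* The error probability costs a rate of at most e/2, with [r + 1] as denominator to allow r = 0;
   the additive bit costs 1/n <= e/2. *)
have d0 : 0 < e / 2 / (r + 1) by rewrite divr_gt0// ltr_wpDl.
have near_n : (\forall n \near \oo, [/\ error_probability ch (c n) < e / 2 / (r + 1),
    average_distortion ch (c n) < D + e & (2 / e) < n%:R :> R])%classic.
  near=> n; split; near: n.
  - exact: (cvgr_lt _ Pe0).
  - exact: limn_esup_le_near.
  - exact: nbhs_infty_gtr.
have [n [Pn Dn ne]] := filter_ex near_n.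
have n0' : 0 < n%:R :> R by apply: lt_trans ne; rewrite divr_gt0.
have n0 : (0 < n)%N by rewrite -(ltr0n R).
have M0 := num_messages_gt0 r n.
have PE0 : 0 <= error_probability ch (c n) by apply: Pr_ge0; exact: code_law_ge0.
have PE1 : error_probability ch (c n) <= 1.
  have [L0 <-] := is_pmf_code_law ch (c n) M0.
  by rewrite /error_probability /Pr big_mkcond; apply: ler_sum => t _; case: ifP.
have rate (I : R) : (1 - error_probability ch (c n)) * log2 (num_messages r n)%:R <=
    n%:R * I + 1 -> r - e <= I.
  move=> nI; have : (1 - error_probability ch (c n)) * (n%:R * r) <= n%:R * I + 1.
    by apply: le_trans nI; rewrite ler_wpM2l ?subr_ge0// log2_num_messages.
  move=> h; rewrite -(ler_pM2l n0').
  have h1 : error_probability ch (c n) * r <= e / 2.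
    apply: (@le_trans _ _ (e / 2 / (r + 1) * (r + 1))).
      by apply: ler_pM => //; [exact: ltW | rewrite lerDl].
    by rewrite divfK// gt_eqF// ltr_wpDl.
  have h2 : 1 <= n%:R * (e / 2).
    by move: ne; rewrite ltr_pdivrMr// mulrA ler_pdivlMr// mul1r => /ltW.
  have h3 : n%:R * (error_probability ch (c n) * r) <= n%:R * (e / 2).
    by rewrite ler_wpM2l// ltW.
  by move: h h2 h3; rewrite mulrBl mul1r; lra.
have [sh shE] := block_estimator ch (c n) z0.
have Bpmf := is_pmf_block_input ch (c n) z0 M0 n0.
have [P [sh' [Ppmf P1 P3 Psh]]] := reduce_side_info ch Bpmf sh.
exists P, sh'; split=> //.
  rewrite (rate_bound_unit _ Ppmf) P1 P3 le_min.
  by rewrite (rate _ (first_converse ch (c n) z0 M0 n0))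
    (rate _ (third_converse ch (c n) z0 M0 n0)).
by rewrite (le_trans Psh)// shE ltW.
Unshelve. all: by end_near. Qed.

End Bound.

Theorem theorem5 (R : realType) (X S Y Z Sh : finType)
    (ch : isac_channel R X S Y Z Sh) (D : R) (hD : (Dmin ch <= D%:E)%E) :
  exists m : R, is_maximum (outer_values ch D) m /\
                (capacity_distortion ch D <= m%:E)%E.
Proof.
have [P1 [P1pmf P1D]] := feasible_of_Dmin hD.
(* A pmf has a point of nonzero mass, so the alphabets are inhabited; [z0] overwrites erased letters
   and [s0] is a default estimate. *)
have [[_ x] _] : exists w, P1 w != 0.
  by apply: sum_neq0_ex; case: P1pmf => _ ->; exact: oner_neq0.
have [s _] : exists s, state_pmf ch s != 0.
  by apply: sum_neq0_ex; case: (state_pmfP ch) => _ ->; exact: oner_neq0.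
have [[_ z0] _] : exists yz, transition ch x s yz != 0.
  by apply: sum_neq0_ex; case: (transitionP ch x s) => _ ->; exact: oner_neq0.
have [sh _ _] := P1D; pose s0 := sh tt tt z0.
(* ['I_a.+1] and ['I_b.+1] have the largest sizes allowed, |X| + 2 and (|X| + 2)|X| + 1. *)
pose a := #|X|.+1; pose b := (a.+1 * #|X|)%N.
have embed (U V : finType) (P : U * V * X -> R) : (#|U| <= #|X| + 2)%N ->
    (#|V| <= #|U| * #|X| + 1)%N -> is_pmf P -> distortion_feasible ch P D ->
    exists P' : 'I_a.+1 * 'I_b.+1 * X -> R,
    [/\ is_pmf P', distortion_feasible ch P' D & rate_bound ch P' = rate_bound ch P].
  rewrite addn2 => Ua Vb; apply: relabel_ordinals => //.
  by rewrite (leq_trans Vb)// addn1 ltnS leq_mul2r Ua orbT.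
have [|P [Ppmf PD Pmax]] := @rate_bound_max _ _ _ _ _ _ ch 'I_a.+1 'I_b.+1 D.
  have [||P [Ppmf PD _]] := embed _ _ P1 _ _ P1pmf P1D; last by exists P.
    by rewrite card_unit addn2.
  by rewrite card_unit addn1.
have ubP m : outer_values ch D m -> m <= rate_bound ch P.
  move=> [U [V [Q [cU cV Qpmf QD ->]]]].
  by have [Q' [Q'pmf Q'D <-]] := embed U V Q cU cV Qpmf QD; exact: Pmax.
exists (rate_bound ch P); split; first split=> //.
  by exists 'I_a.+1, 'I_b.+1, P; split; rewrite ?card_ord ?addn2 ?addn1.
apply: ge_ereal_sup => _ [r [r0 rD] <-]; rewrite lee_fin.
have [Q [Qpmf QD rQ]] := achievable_rate_bound z0 s0 r0 rD.
(* With U a singleton, the allowed size of V is |X| + 1, exactly what the reduction provides. *)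
apply: le_trans rQ _; apply: ubP; exists unit, 'I_(#|X|.+1), Q; split=> //.
  by rewrite card_unit addn2.
by rewrite card_ord card_unit mul1n addn1.
Qed.
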